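(* There is an absolute constant $0<c<1$ such that \[ \deg_{I_0,I_1,I_*}((f\circ\mathrm{MP}^*_m)|_{\le\theta})\ge\min\left\{cm\deg_{I_0,I_1,I_*}(f),\ \frac{c\theta}{m\log(n+m)}-n\right\}, \] \[ \deg_{I_0,I_1,I_*}((f\circ\neg\mathrm{MP}^*_m)|_{\le\theta})\ge\min\left\{cm\deg_{I_0,I_1,I_*}(f),\ \frac{c\theta}{m\log(n+m)}-n\right\} \] for all positive integers $n,m,\theta$, all functions $f\colon\{0,1\}^n\to\{0,1,*\}$, and all nonempty convex sets $I_0,I_1,I_*\subseteq\mathbb{R}$.
   Context: For a (partial) function $g\colon X\to\{0,1,*\}$ on a finite $X\subset\mathbb{R}^N$, an $(I_0,I_1,I_* )$-approximant is a real polynomial mapping $g^{-1}(0),g^{-1}(1),g^{-1}( * )$ into $I_0,I_1,I_*$ respectively, and $\deg_{I_0,I_1,I_*}(g)$ is the least degree of such an approximant. $\mathrm{MP}^*_m\colon\{0,1,\dots,m^2\}^m\to\{0,1\}$ is given by $\mathrm{MP}^*_m(t_1,\dots,t_m)=1$ iff $t_i\ge1$ for all $i$, and $\neg\mathrm{MP}^*_m=1-\mathrm{MP}^*_m$. The composition $f\circ g$ on $(\{0,1,\dots,m^2\}^m)^n\subseteq\mathbb{N}^{nm}$ is $(f\circ g)(y_1,\dots,y_n)=f(g(y_1),\dots,g(y_n))$. For $h$ on a subset of $\mathbb{N}^{N}$, $h|_{\le\theta}$ is its restriction to inputs $x$ with $\sum_ix_i\le\theta$. Logarithms base 2. *)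

(* Defs.v *)
From HB Require Import structures.
From mathcomp Require Import all_boot all_order all_algebra.
From mathcomp Require Import -(notations) mpoly.
From mathcomp Require Import boolp classical_sets reals convex exp.

Set Implicit Arguments.
Unset Strict Implicit.
Unset Printing Implicit Defensive.

Import Order.TTheory GRing.Theory Num.Theory.
Local Open Scope classical_set_scope.
Local Open Scope ring_scope.

(* The value set {0,1,*} is [option bool], with [None] standing for *.  *)
Definition target (R : realType) (I0 I1 Is : set R) (a : option bool) : set R :=
  match a with Some false => I0 | Some true => I1 | None => Is end.

(* msize is the total degree plus one, and 0 at the zero polynomial, so the    *)
(* zero polynomial is given degree 0.                                          *)
Definition totdeg (R : realType) (N : nat) (p : mpoly N R) : nat :=
  (mpoly.msize p).-1.

(* A function on a finite subset of R^N is given by a finite alphabet S with   *)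
(* an injective reading v : S -> R of its letters as reals, a domain X of      *)
(* words over S, and values g of which only those on X matter; a word x is the *)
(* real point map_mx v x.                                                      *)
Definition approximant (R : realType) (I0 I1 Is : set R) (S : finType)
    (v : S -> R) (N : nat) (X : {set 'rV[S]_N}) (g : 'rV[S]_N -> option bool)
    (p : mpoly N R) : Prop :=
  forall x, x \in X ->
    target I0 I1 Is (g x) (meval (map_mx v x 0) p).

Definition is_approx_deg (R : realType) (I0 I1 Is : set R) (S : finType)
    (v : S -> R) (N : nat) (X : {set 'rV[S]_N}) (g : 'rV[S]_N -> option bool)
    (d : nat) : Prop :=
  (exists2 p, approximant I0 I1 Is v X g p & totdeg p = d) /\
  (forall p, approximant I0 I1 Is v X g p -> (d <= totdeg p)%N).

(* The default 0 is not reached for nonempty I0, I1, Is: see approx_degP.      *)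
Definition approx_deg (R : realType) (I0 I1 Is : set R) (S : finType)
    (v : S -> R) (N : nat) (X : {set 'rV[S]_N}) (g : 'rV[S]_N -> option bool)
    : nat :=
  xget 0%N [set d | is_approx_deg I0 I1 Is v X g d].

Definition bool_val (R : realType) (b : bool) : R := b%:R.
Definition ord_val (R : realType) (k : nat) (i : 'I_k) : R := i%:R.

Definition deg_cube (R : realType) (I0 I1 Is : set R) (n : nat)
    (f : 'rV[bool]_n -> option bool) : nat :=
  approx_deg I0 I1 Is (@bool_val R) [set: 'rV[bool]_n]%SET f.

Definition weight_le (k N theta : nat) : {set 'rV['I_k]_N} :=
  [set x : 'rV['I_k]_N | (\sum_(i < N) x ord0 i <= theta)%N]%SET.

Definition deg_le (R : realType) (I0 I1 Is : set R) (k N theta : nat)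
    (h : 'rV['I_k]_N -> option bool) : nat :=
  approx_deg I0 I1 Is (@ord_val R k) (weight_le k N theta) h.

Definition MPstar (m : nat) (t : 'rV['I_(m ^ 2).+1]_m) : bool :=
  [forall i, (1 <= t ord0 i)%N].

Definition negMPstar (m : nat) (t : 'rV['I_(m ^ 2).+1]_m) : bool :=
  ~~ MPstar t.

(* The input of length n * m is the concatenation of the n rows y_1, ..., y_n  *)
(* of vec_mx y.                                                                *)
Definition block_comp (S : Type) (n m : nat) (f : 'rV[bool]_n -> option bool)
    (g : 'rV[S]_m -> bool) (y : 'rV[S]_(n * m)) : option bool :=
  f (\row_(i < n) g (row i (vec_mx y))).

Definition log2 (R : realType) (x : R) : R := ln x / ln 2.

Lemma approximant_exists (R : realType) (I0 I1 Is : set R) (S : finType)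
    (v : S -> R) (N : nat) (X : {set 'rV[S]_N}) (g : 'rV[S]_N -> option bool) :
  injective v -> I0 !=set0 -> I1 !=set0 -> Is !=set0 ->
  exists p, approximant I0 I1 Is v X g p.
Proof.
move=> vinj [a0 I0a] [a1 I1a] [a2 Isa].
pose a b := match b with Some false => a0 | Some true => a1 | None => a2 end.
have aP b : target I0 I1 Is b (a b) by case: b => [[]|].
pose q (z : 'rV[S]_N) : mpoly N R := \sum_(i < N)
  (mpolyX R (mnm1 i) - mpolyC N (v (z 0 i))) ^+ 2.
have qE z x : meval (map_mx v x 0) (q z) =
    \sum_(i < N) (v (x 0 i) - v (z 0 i)) ^+ 2.
  rewrite rmorph_sum; apply: eq_bigr => i _ /=.
  by rewrite rmorphXn rmorphB /= mevalXU mevalC mxE.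
have q0 z : meval (map_mx v z 0) (q z) = 0.
  by rewrite qE big1 // => i _; rewrite subrr expr0n.
have qn0 z x : z != x -> meval (map_mx v x 0) (q z) != 0.
  apply: contra_neq; rewrite qE => /eqP.
  rewrite psumr_eq0 => [/allP h|i _]; last exact: sqr_ge0.
  apply/rowP => i; apply: vinj; apply/esym/eqP.
  by have := h i (mem_index_enum i); rewrite /= sqrf_eq0 subr_eq0.
pose Q x := \prod_(z | z != x) q z.
pose ev (x : 'rV[S]_N) := meval (map_mx v x 0).
have Q0 x y : x != y -> ev y (Q x) = 0.
  move=> xy; rewrite /ev rmorph_prod (bigD1 y) 1?eq_sym//=.
  by rewrite q0 mul0r.
have Qn0 x : ev x (Q x) != 0.
  by rewrite /ev rmorph_prod; apply/prodf_neq0 => z; exact: qn0.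
exists (\sum_x mpolyC N (a (g x) / ev x (Q x)) * Q x) => x _.
rewrite raddf_sum (bigD1 x)//= big1 ?addr0.
  by rewrite rmorphM /= mevalC divfK //; apply: Qn0.
by move=> z zx; rewrite rmorphM /= [X in _ * X]Q0 ?mulr0.
Qed.

Lemma approx_degP (R : realType) (I0 I1 Is : set R) (S : finType)
    (v : S -> R) (N : nat) (X : {set 'rV[S]_N}) (g : 'rV[S]_N -> option bool) :
  injective v -> I0 !=set0 -> I1 !=set0 -> Is !=set0 ->
  is_approx_deg I0 I1 Is v X g (approx_deg I0 I1 Is v X g).
Proof.
move=> vinj I0n I1n Isn.
have [p pP] := approximant_exists X g vinj I0n I1n Isn.
pose D d := `[< exists2 p, approximant I0 I1 Is v X g p & totdeg p = d >].
have exD : exists d, D d by exists (totdeg p); apply/asboolP; exists p.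
case: (ex_minnP exD) => d /asboolP dP dmin.
apply: (@xgetPex _ 0%N [set d | is_approx_deg I0 I1 Is v X g d]).
exists d; split => // r rP.
by apply: dmin; apply/asboolP; exists r.
Qed.

Lemma bool_val_inj (R : realType) : injective (@bool_val R).
Proof. by move=> [] [] //= /eqP; rewrite /bool_val eqr_nat. Qed.

Lemma ord_val_inj (R : realType) (k : nat) : injective (@ord_val R k).
Proof. by move=> i j /eqP; rewrite eqr_nat => /eqP /val_inj. Qed.

(* Main.v *)
Require Import Defs.
From HB Require Import structures.
From mathcomp Require Import all_boot all_order all_algebra.
From mathcomp Require Import -(notations) mpoly.
From mathcomp Require Import boolp classical_sets reals convex exp.
From mathcomp Require Import sequences interval_inference.
From mathcomp Require Import zify ring lra.

Set Implicit Arguments.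
Unset Strict Implicit.
Unset Printing Implicit Defensive.

Import Order.TTheory GRing.Theory Num.Theory.
Local Open Scope classical_set_scope.
Local Open Scope ring_scope.

(* An approximant p of f o MP* is averaged over random inputs: for z in {0,1}^n *)
(* draw the i-th block from L_{z_i}, where L_0 and L_1 are distributions on the *)
(* zeros and the ones of MP* with the same moments of degree at most d = m/128. *)
(* The average of p is then a multilinear polynomial in z in which every        *)
(* variable costs degree d + 1, and convexity keeps its values in I_0, I_1, I_*.*)
(*                                                                              *)
(* L_0 and L_1 come from measures A, B on {1, .., m^2} with delta_0 + A = B on  *)
(* polynomials of degree at most d and A light: L_1 is the m-fold power of B,   *)
(* minus a tiny measure with the low moments of the power of A, and L_0 is the  *)
(* power of delta_0 + A minus the power of A. Since A and B decay like          *)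
(* t^-2 exp(-t / O(m)), the product of the blocks rarely exceeds weight theta;  *)
(* there a point is replaced, through Newton's interpolation formula in its few *)
(* large coordinates, by nearby points of small weight, which changes no moment *)
(* of degree at most deg p and at most doubles the mass of any point.           *)

(** * Weights on the line that annihilate polynomials *)

Lemma sum_ord_delta (R : pzSemiRingType) (r c : nat) (g : nat -> R) : (c <= r)%N ->
  \sum_(t < r.+1) (t == c :> nat)%:R * g t = g c.
Proof.
move=> cr; rewrite (bigD1 (inord c)) //= inordK ?ltnS // eqxx mul1r big1 ?addr0 //.
move=> i ic; case: eqP => [ec|_]; last by rewrite mul0r.
by move: ic; rewrite -ec inord_val eqxx.
Qed.

Lemma sum_ord_symmetric (V : nmodType) (M : nat) (F : nat -> V) :
  (forall i, (i <= M)%N -> F (M - i)%N = F (M + i)%N) ->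
  \sum_(l < (2 * M).+1) F l = F M + \sum_(i < M) F (M + i.+1)%N *+ 2.
Proof.
move=> symF; rewrite -(big_mkord predT) (big_cat_nat (n := M)) //=; last lia.
rewrite [X in _ + X]big_ltn; last lia.
rewrite addrCA; congr (_ + _).
under [RHS]eq_bigr do rewrite mulr2n.
rewrite big_split /=; congr (_ + _).
  rewrite big_nat_rev big_mkord; apply: eq_bigr => i _.
  by rewrite add0n symF.
rewrite -[M.+1]add0n big_addn (_ : (2 * M).+1 - M.+1 = M)%N; last lia.
by rewrite big_mkord; apply: eq_bigr => i _; congr F; lia.
Qed.

Lemma sum_ord_split01 (V : nmodType) (r : nat) (F : nat -> V) : (0 < r)%N ->
  \sum_(t < r.+1) F t = F 0%N + F 1%N + \sum_(t < r.+1 | (1 < t)%N) F t.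
Proof.
case: r => // r _; rewrite 2!big_ord_recl /= addrA; congr (_ + _).
by rewrite [RHS]big_mkcond 2!big_ord_recl /= !add0r.
Qed.

Lemma sum_inv_sq_ge (R : realFieldType) (r : nat) (tau : R) : 0 < tau ->
  \sum_(t < r.+1 | tau <= t%:R) t%:R ^- 2 <= 2 / tau.
Proof.
move=> tau0; pose g (t : nat) : R := 2 / Num.max t%:R tau.
have max_gt0 t : 0 < Num.max t%:R tau by rewrite lt_max tau0 orbT.
have inv_sq_le t : (if tau <= t%:R then t%:R ^- 2 else 0) <= g t - g t.+1.
  rewrite /g; have [tau_t|t_tau] := leP tau t%:R; last first.
    rewrite subr_ge0 ler_pM2l // lef_pV2 ?posrE //.
    by rewrite le_max lexx orbT.
  have t0 : 0 < t%:R :> R by exact: lt_le_trans tau_t.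
  rewrite max_l; last by rewrite (le_trans tau_t) // ler_nat.
  rewrite -subr_ge0 -[t.+1%:R]natr1.
  have -> : 2 / t%:R - 2 / (t%:R + 1) - t%:R ^- 2 =
      (t%:R - 1) / (t%:R ^+ 2 * (t%:R + 1)) :> R.
    by field; rewrite !gt_eqF //; lra.
  rewrite divr_ge0 ?subr_ge0 ?ler1n -?(ltr0n R) // mulr_ge0 ?exprn_ge0 //; lra.
rewrite big_mkcond; apply: (@le_trans _ _ (\sum_(t < r.+1) (g t - g t.+1))).
  by apply: ler_sum.
rewrite -(big_mkord predT (fun t => g t - g t.+1)).
rewrite (@telescope_sumr_eq _ 0 r.+1 (fun t => - g t)) => [|//|t _]; last first.
  by rewrite opprK addrC.
have g0 : g 0%N = 2 / tau by rewrite /g max_r // ltW.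
by rewrite opprK addrC g0 gerBl divr_ge0 // ltW.
Qed.

Section FiniteDifferences.
Variable R : comNzRingType.

Lemma sum_sign_bin (a : nat) :
  \sum_(b < a.+1) (-1) ^+ b * 'C(a, b)%:R = (a == 0)%N%:R :> R.
Proof.
rewrite -expr0n -[X in _ = X ^+ _](subrr 1) exprBn; apply: eq_bigr => b _.
by rewrite !expr1n !mulr1 mulr_natr.
Qed.

Lemma sum_sign_bin_mul (a : nat) (F : nat -> R) :
  \sum_(b < a.+2) (-1) ^+ b * 'C(a.+1, b)%:R * (b%:R * F b) =
  - a.+1%:R * \sum_(b < a.+1) (-1) ^+ b * 'C(a, b)%:R * F b.+1.
Proof.
rewrite big_ord_recl mul0r mulr0 add0r mulr_sumr; apply: eq_bigr => b _.
rewrite lift0.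
transitivity ((-1) ^+ b.+1 * (b.+1 * 'C(a.+1, b.+1))%:R * F b.+1).
  by rewrite natrM; ring.
by rewrite -mul_bin_diag natrM exprS; ring.
Qed.

Lemma finite_difference_eq0 (p : {poly R}) (a : nat) (c : R) : (size p <= a)%N ->
  \sum_(b < a.+1) (-1) ^+ b * 'C(a, b)%:R * p.[b%:R + c] = 0.
Proof.
elim/poly_ind: p a c => [|p k IH] a c.
  by move=> _; rewrite big1 // => b _; rewrite horner0 mulr0.
case: a => [|a]; first by rewrite leqn0 size_poly_eq0 => /eqP ->;
  rewrite big1 // => b _; rewrite horner0 mulr0.
move=> pa; have {}pa : (size p <= a)%N.
  move: pa; rewrite size_MXaddC; case: ifP => // /andP[/eqP -> _] _.
  by rewrite size_poly0.
transitivity (\sum_(b < a.+2) (-1) ^+ b * 'C(a.+1, b)%:R * (b%:R * p.[b%:R + c]) +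
    c * (\sum_(b < a.+2) (-1) ^+ b * 'C(a.+1, b)%:R * p.[b%:R + c]) +
    k * \sum_(b < a.+2) (-1) ^+ b * 'C(a.+1, b)%:R).
  rewrite !mulr_sumr -!big_split /=; apply: eq_bigr => b _.
  by rewrite hornerMXaddC; ring.
rewrite (IH _ _ (leqW pa)) sum_sign_bin !mulr0 !addr0.
rewrite (sum_sign_bin_mul a (fun b => p.[b%:R + c])).
under eq_bigr do rewrite -natr1 -addrA.
by rewrite IH // mulr0.
Qed.

End FiniteDifferences.

Definition annihilates (R : nzRingType) (r d : nat) (w : nat -> R) : Prop :=
  forall p : {poly R}, (size p <= d)%N -> \sum_(t < r.+1) w t * p.[t%:R] = 0.

Lemma annihilates_sum (R : nzRingType) (r d : nat) (w : nat -> R) :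
  annihilates r d.+1 w -> \sum_(t < r.+1) w t = 0.
Proof.
move=> wann; rewrite -[RHS](wann 1) ?size_poly1 //.
by apply: eq_bigr => t _; rewrite hornerE mulr1.
Qed.

Section AddNode.
Variable R : numFieldType.
Implicit Types (w : nat -> R) (r d q t : nat).

(* Since x / 0 = 0, the first term vanishes at the new node t = q. *)
Definition add_node r q w t : R :=
  w t / (t%:R - q%:R) - (t == q)%:R * \sum_(s < r.+1) w s / (s%:R - q%:R).

Lemma add_node_neq r q w t : t != q -> add_node r q w t = w t / (t%:R - q%:R).
Proof. by move=> tq; rewrite /add_node (negbTE tq) mul0r subr0. Qed.

(* (p - p(q)) / (X - q) is a polynomial of degree one less than p. *)
Lemma add_node_annihilates r d q w : (q <= r)%N -> w q = 0 ->
  annihilates r d w -> annihilates r d.+1 (add_node r q w).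
Proof.
move=> qr wq0 wann p pd.
have [s sE] : exists s, p - p.[q%:R]%:P = s * ('X - q%:R%:P).
  by apply/factor_theorem; rewrite /root !hornerE subrr.
have sd : (size s <= d)%N.
  have [->|s0] := eqVneq s 0; first by rewrite size_poly0.
  have : (size (s * ('X - q%:R%:P))%R <= d.+1)%N.
    rewrite -sE (leq_trans (size_polyD _ _)) // geq_max pd size_polyN.
    exact: leq_trans (size_polyC_leq1 _) _.
  by rewrite size_Mmonic ?monicXsubC // size_XsubC addn2.
rewrite -[RHS](wann s sd) /add_node.
under eq_bigr do rewrite mulrBl -[X in _ - X]mulrA.
rewrite sumrB (sum_ord_delta (fun t => _ * p.[t%:R])) // mulr_suml -sumrB.
apply: eq_bigr => t _; rewrite -mulrBr.
have [->|tq] := eqVneq (t : nat) q; first by rewrite wq0 !mul0r.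
have -> : p.[t%:R] - p.[q%:R] = s.[t%:R] * (t%:R - q%:R).
  by have := congr1 (horner^~ t%:R) sE; rewrite !hornerE.
by rewrite mulrCA divfK ?subr_eq0 ?eqr_nat // mulrC.
Qed.

End AddNode.

Section CentralBinomial.
Variable R : realType.
Implicit Types (K M r i t : nat).

Definition bin_ratio M i : R := 'C(2 * M, M + i)%:R / 'C(2 * M, M)%:R.

Lemma bin_central_neq0 M : 'C(2 * M, M)%:R != 0 :> R.
Proof. by rewrite pnatr_eq0 -lt0n bin_gt0; lia. Qed.

Lemma bin_ratio_ge0 M i : 0 <= bin_ratio M i.
Proof. by rewrite divr_ge0. Qed.

Lemma bin_ratio0 M : bin_ratio M 0 = 1.
Proof. by rewrite /bin_ratio addn0 divff // bin_central_neq0. Qed.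

Lemma bin_ratioS M i : (i < M)%N ->
  bin_ratio M i.+1 = bin_ratio M i * ((M - i)%:R / (M + i.+1)%:R).
Proof.
move=> iM; rewrite /bin_ratio -mulrAC; congr (_ / _).
have := mul_bin_left (2 * M) (M + i).
rewrite (_ : 2 * M - (M + i) = M - i)%N; last lia.
move=> /(congr1 (fun k : nat => k%:R : R)); rewrite !natrM addnS => binS.
by rewrite mulrA [_ * (M - i)%:R]mulrC -binS mulrC mulKf // pnatr_eq0.
Qed.

Lemma bin_ratio_le_expR M i : (i <= M)%N ->
  bin_ratio M i <= expR (- ((i ^ 2)%:R / (2 * M).+1%:R)).
Proof.
elim: i => [|i IH] iM; first by rewrite bin_ratio0 mul0r oppr0 expR0.
have ratio_le : (M - i)%:R / (M + i.+1)%:R <=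
    expR (- ((2 * i).+1%:R / (2 * M).+1%:R)) :> R.
  apply: le_trans (expR_ge1Dx _); rewrite -subr_ge0.
  have -> : 1 - (2 * i).+1%:R / (2 * M).+1%:R - (M - i)%:R / (M + i.+1)%:R =
     (2 * i).+1%:R * ((M + i.+1)%:R^-1 - (2 * M).+1%:R^-1) :> R.
    rewrite natrB 1?ltnW // -!natr1 natrD -natr1 !natrM.
    have i_ge0 : 0 <= i%:R :> R by []. have M_ge0 : 0 <= M%:R :> R by [].
    field; rewrite !gt_eqF //; lra.
  rewrite mulr_ge0 // subr_ge0 lef_pV2 ?posrE ?ltr0n ?addnS // ler_nat; lia.
have -> : - ((i.+1 ^ 2)%:R / (2 * M).+1%:R) =
    - ((i ^ 2)%:R / (2 * M).+1%:R) + - ((2 * i).+1%:R / (2 * M).+1%:R) :> R.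
  by rewrite -opprD -mulrDl -natrD; congr (- (_%:R / _)); lia.
by rewrite bin_ratioS // expRD ler_pM ?bin_ratio_ge0 ?divr_ge0 // IH // ltnW.
Qed.

Definition square_coef M i : R :=
  if i == 0%N then 1 else (-1) ^+ i * bin_ratio M i *+ 2.

(* Alternating binomial weights of row 2M, folded at the centre, placed at the  *)
(* nodes K i^2: a polynomial of degree < M in K i^2 has degree < 2M in i.       *)
Definition square_weight K M t : R :=
  \sum_(i < M.+1) (t == K * i ^ 2)%N%:R * square_coef M i.

Lemma sum_square_coef_eq0 K M (p : {poly R}) : (size p <= M)%N ->
  \sum_(i < M.+1) square_coef M i * p.[(K * i ^ 2)%:R] = 0.
Proof.
have [->|p0] := eqVneq p 0.
  by move=> _; rewrite big1 // => i _; rewrite horner0 mulr0.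
move=> pM; pose s := p \Po (K%:R *: 'X^2).
have sE x : s.[x] = p.[K%:R * x ^+ 2] by rewrite horner_comp !hornerE.
have sM : (size s <= 2 * M)%N.
  apply: leq_trans (size_comp_poly_leq _ _) _.
  have : (size (K%:R *: 'X^2 : {poly R}) <= 3)%N.
    by rewrite (leq_trans (size_scale_leq _ _)) // size_polyXn.
  by move: p0; rewrite -size_poly_gt0; nia.
pose F (l : nat) : R := (-1) ^+ l * 'C(2 * M, l)%:R * s.[l%:R - M%:R].
have symF i : (i <= M)%N -> F (M - i)%N = F (M + i)%N.
  move=> iM; rewrite /F; congr (_ * _ * _).
  - by rewrite -signr_odd oddB // -oddD signr_odd.
  - by rewrite -bin_sub; [congr (_%:R); congr ('C(_, _)); lia|lia].
  - by rewrite !sE natrB // natrD; congr (p.[_ * _]); ring.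
apply: (mulfI (_ : (-1) ^+ M * 'C(2 * M, M)%:R != 0)).
  by rewrite mulf_neq0 ?signr_eq0 ?bin_central_neq0.
rewrite mulr0 -[RHS](finite_difference_eq0 (- M%:R) sM) (sum_ord_symmetric symF).
rewrite big_ord_recl mulrDr mulr_sumr; congr (_ + _).
  by rewrite /F sE subrr expr0n /square_coef /= muln0 mulr0 mul1r.
apply: eq_bigr => i _; rewrite lift0 /F sE /square_coef /bin_ratio natrD addrAC subrr.
rewrite add0r natrM natrX exprD /=.
by field; rewrite bin_central_neq0.
Qed.

Lemma square_weight_annihilates K M r : (K * M ^ 2 <= r)%N ->
  annihilates r M (square_weight K M).
Proof.
move=> KMr p pM; rewrite -[RHS](sum_square_coef_eq0 K pM).
under eq_bigr do rewrite mulr_suml.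
rewrite exchange_big; apply: eq_bigr => i _ /=.
under eq_bigr do rewrite -mulrA.
rewrite (sum_ord_delta (fun t => _ * p.[t%:R])) // (leq_trans _ KMr) //.
by rewrite leq_mul2l leq_sqr -ltnS ltn_ord orbT.
Qed.

Lemma square_weight_node K M i : (0 < K)%N -> (i <= M)%N ->
  square_weight K M (K * i ^ 2)%N = square_coef M i.
Proof.
move=> K0 iM; rewrite /square_weight -[RHS](sum_ord_delta (square_coef M) iM).
apply: eq_bigr => j _; congr (_%:R * _).
by rewrite eqn_pmul2l // eqn_sqr eq_sym.
Qed.

Lemma square_weight_neq0 K M t : square_weight K M t != 0 ->
  exists2 i, (i <= M)%N & t = (K * i ^ 2)%N.
Proof.
case: (pickP (fun i : 'I_M.+1 => t == K * i ^ 2)%N) => [i /eqP -> _|no_node].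
  by exists i; rewrite // -ltnS.
by rewrite /square_weight big1 ?eqxx // => i _; rewrite no_node mul0r.
Qed.

Lemma square_weight0 K M : (0 < K)%N -> square_weight K M 0 = 1.
Proof. by move=> K0; rewrite -(muln0 K) -[X in (K * X)%N]/(0 ^ 2)%N square_weight_node. Qed.

Lemma square_weight_gap K M t : (0 < t < K)%N -> square_weight K M t = 0.
Proof.
move=> tK; apply: contraTeq tK => /square_weight_neq0[[|i] _ ->].
  by rewrite muln0.
by rewrite negb_and -!leqNgt leq_pmulr ?orbT // expn_gt0.
Qed.

Lemma normr_square_coef M i : (0 < i)%N -> `|square_coef M i| = 2 * bin_ratio M i.
Proof.
move=> i0; rewrite /square_coef gtn_eqF // normrMn normrM normr_sign mul1r.
by rewrite ger0_norm ?bin_ratio_ge0 // mulr_natl.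
Qed.

Lemma square_weight_le_expR K M t : (0 < K)%N -> (0 < t)%N ->
  `|square_weight K M t| <= 2 * expR (- (t%:R / (K * (2 * M).+1)%:R)).
Proof.
move=> K0 t0; have [->|] := eqVneq (square_weight K M t) 0.
  by rewrite normr0 mulr_ge0 // expR_ge0.
case/square_weight_neq0=> i iM tE; rewrite tE square_weight_node //.
have i0 : (0 < i)%N by move: t0; rewrite tE; case: i {iM tE} => //; rewrite muln0.
rewrite normr_square_coef // ler_pM2l //; apply: le_trans (bin_ratio_le_expR iM) _.
by rewrite !natrM -mulf_div divff ?mul1r // pnatr_eq0 -lt0n.
Qed.

Lemma square_weight_mass K M r : (0 < K)%N -> (K * M ^ 2 <= r)%N ->
  \sum_(t < r.+1) `|square_weight K M t| / t%:R <= 4 / K%:R.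
Proof.
move=> K0 KMr.
have node_le (i : 'I_M.+1) : `|square_coef M i| / (K * i ^ 2)%:R <=
    2 / K%:R * (if 1 <= i%:R :> R then i%:R ^- 2 else 0).
  rewrite ler1n; case: i => -[|i] iM /=; first by rewrite muln0 invr0 !mulr0.
  rewrite normr_square_coef // natrM natrX invfM mulrACA.
  rewrite ler_wpM2l ?divr_ge0 // ler_piMl ?invr_ge0 ?exprn_ge0 //.
  by apply: le_trans (bin_ratio_le_expR _) _.
apply: (@le_trans _ _ (\sum_(t < r.+1) \sum_(i < M.+1)
    (t == K * i ^ 2 :> nat)%N%:R * (`|square_coef M i| / t%:R))).
  apply: ler_sum => t _; apply: le_trans (ler_wpM2r _ (ler_norm_sum _ _ _)) _ => //.
  by rewrite mulr_suml ler_sum // => i _; rewrite normrM normr_nat mulrA.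
rewrite exchange_big /=.
apply: (@le_trans _ _ (\sum_(i < M.+1) 2 / K%:R * (if 1 <= i%:R :> R then i%:R ^- 2 else 0))).
  apply: ler_sum => i _; apply: le_trans (node_le i).
  rewrite (sum_ord_delta (fun t => _ / t%:R)) // (leq_trans _ KMr) //.
  by rewrite leq_mul2l leq_sqr -ltnS ltn_ord orbT.
rewrite -mulr_sumr -big_mkcond (_ : 4 / K%:R = 2 / K%:R * 2); last by ring.
by rewrite ler_wpM2l ?divr_ge0 //; have := @sum_inv_sq_ge R M 1 ltr01; rewrite divr1.
Qed.

End CentralBinomial.

(** * Two light measures matching up to the mass at zero *)

Section ThreeNodeWeight.
Variables (R : realFieldType) (r d Q : nat) (w : nat -> R).
Hypothesis Q_gt1 : (1 < Q)%N.
Hypothesis w_gap : forall t, (0 < t < 2 * Q)%N -> w t = 0.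

Let w1 := add_node r 1 w.

Definition three_node_weight (t : nat) : R := Q%:R * add_node r Q w1 t.

Let QR_ge2 : 2 <= Q%:R :> R. Proof. by rewrite ler_nat. Qed.

Let QR_pred_gt0 : 0 < Q%:R - 1 :> R. Proof. by rewrite subr_gt0 ltr1n. Qed.

Let w_neq0_ge t : (0 < t)%N -> w t != 0 -> (2 * Q <= t)%N.
Proof. by move=> t0; apply: contra_neqT; rewrite -ltnNge => tQ; rewrite w_gap ?t0. Qed.

Let far_inv_le (t q : nat) : (0 < 2 * q <= t)%N ->
  0 < t%:R - q%:R :> R /\ (t%:R - q%:R)^-1 <= 2 / t%:R :> R.
Proof.
move=> /andP[q0 qt]; have t0 := leq_trans q0 qt; have tR_gt0 : 0 < t%:R :> R by rewrite ltr0n.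
have qtR_le : 2 * q%:R <= t%:R :> R by rewrite -natrM ler_nat.
have sub_gt0 : 0 < t%:R - q%:R :> R by lra.
by split=> //; rewrite ler_pdivlMr // mulrC ler_pdivrMr //; lra.
Qed.

Lemma three_node_far t : (1 < t)%N -> t != Q ->
  `|three_node_weight t| <= 4 * Q%:R * `|w t| / t%:R ^+ 2.
Proof.
move=> t1 tQ; rewrite /three_node_weight add_node_neq // /w1 add_node_neq ?gtn_eqF //.
have [->|wt] := eqVneq (w t) 0; first by rewrite !(mul0r, mulr0, normr0).
have t_ge := w_neq0_ge (ltnW t1) wt.
have [|t_sub1_gt0 inv_sub1_le] := @far_inv_le t 1; first lia.
have [|t_subQ_gt0 inv_subQ_le] := @far_inv_le t Q; first lia.
rewrite !normrM !normfV (gtr0_norm t_sub1_gt0) (gtr0_norm t_subQ_gt0) normr_nat.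
have -> : 4 * Q%:R * `|w t| / t%:R ^+ 2 = Q%:R * (`|w t| * (2 / t%:R) * (2 / t%:R)) :> R.
  by field; rewrite pnatr_eq0 -lt0n; lia.
rewrite ler_wpM2l // ler_pM ?ler_wpM2l ?mulr_ge0 ?invr_ge0 //; exact: ltW.
Qed.

Hypothesis w_at0 : w 0%N = 1.

Let w1_at0 : w1 0 = -1.
Proof. by rewrite /w1 add_node_neq // w_at0 sub0r mul1r invrN1. Qed.

Lemma three_node_at0 : three_node_weight 0 = 1.
Proof.
rewrite /three_node_weight add_node_neq ?ltn_eqF 1?ltnW // w1_at0 sub0r invrN mulrNN mul1r.
by rewrite divff // pnatr_eq0; lia.
Qed.

Hypothesis Q_le : (Q <= r)%N.
Hypothesis w_ann : annihilates r d w.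

Let r_gt0 : (0 < r)%N. Proof. lia. Qed.

Let w1_ann : annihilates r d.+1 w1.
Proof. by apply: add_node_annihilates => //; apply: w_gap; lia. Qed.

Lemma three_node_annihilates : annihilates r d.+2 three_node_weight.
Proof.
move=> p pd; rewrite /three_node_weight.
under eq_bigr do rewrite -mulrA.
rewrite -mulr_sumr (add_node_annihilates Q_le _ w1_ann) ?mulr0 //.
by rewrite /w1 add_node_neq ?gtn_eqF // w_gap ?mul0r //; lia.
Qed.

Variable sigma : R.
Hypothesis w_mass : \sum_(t < r.+1) `|w t| / t%:R <= sigma.

Let w_far_mass (P : pred nat) : \sum_(t < r.+1 | P t) `|w t| / t%:R <= sigma.
Proof.
apply: le_trans w_mass; rewrite [X in X <= _]big_mkcond; apply: ler_sum => t _.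
by case: ifP => // _; rewrite divr_ge0.
Qed.

Let w1_near1 : `|w1 1 - 1| <= 2 * sigma.
Proof.
have sum_w1 : w1 1 - 1 = - \sum_(t < r.+1 | (1 < t)%N) w1 t.
  have := annihilates_sum w1_ann; rewrite (sum_ord_split01 _ r_gt0) w1_at0; lra.
rewrite sum_w1 normrN; apply: le_trans (ler_norm_sum _ _ _) _.
apply: (@le_trans _ _ (2 * \sum_(t < r.+1 | (1 < t)%N) `|w t| / t%:R)); last first.
  by rewrite ler_pM2l // (w_far_mass (fun t => 1 < t)%N).
rewrite mulr_sumr; apply: ler_sum => t t1.
rewrite /w1 add_node_neq ?gtn_eqF // normrM normfV.
have [|t_sub1_gt0 inv_le] := @far_inv_le t 1; first lia.
by rewrite (gtr0_norm t_sub1_gt0) mulrCA ler_wpM2l // mulr1n.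
Qed.

Lemma three_node_near1 : `|three_node_weight 1 + Q%:R / (Q%:R - 1)| <= 4 * sigma.
Proof.
have -> : three_node_weight 1 + Q%:R / (Q%:R - 1) =
    - (Q%:R / (Q%:R - 1) * (w1 1 - 1)).
  rewrite /three_node_weight add_node_neq ?ltn_eqF //.
  by field; move: QR_ge2 => ?; rewrite gt_eqF ?lt_eqF //; lra.
have ratio_le : Q%:R / (Q%:R - 1) <= 2 :> R by rewrite ler_pdivrMr //; move: QR_ge2; lra.
rewrite normrN normrM [X in _ <= X](_ : _ = 2 * (2 * sigma)); last by ring.
by rewrite ler_pM // gtr0_norm // divr_gt0 // ltr0n; lia.
Qed.

Let three_node_far_mass :
  \sum_(t < r.+1 | (1 < t)%N && (t != Q :> nat)) `|three_node_weight t| <= 2 * sigma.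
Proof.
apply: (@le_trans _ _ (2 * \sum_(t < r.+1 | (1 < t)%N && (t != Q :> nat)) `|w t| / t%:R)).
  rewrite mulr_sumr; apply: ler_sum => t /andP[t1 tQ].
  apply: le_trans (three_node_far t1 tQ) _.
  have [->|wt] := eqVneq (w t) 0; first by rewrite normr0 !(mulr0, mul0r).
  have t_ge := w_neq0_ge (ltnW t1) wt.
  have -> : 4 * Q%:R * `|w t| / t%:R ^+ 2 = 2 * (`|w t| / t%:R) * ((2 * Q)%:R / t%:R) :> R.
    by rewrite natrM; field; rewrite pnatr_eq0 -lt0n; lia.
  rewrite ler_piMr ?mulr_ge0 ?divr_ge0 // ler_pdivrMr ?mul1r ?ler_nat // ltr0n; lia.
by rewrite ler_pM2l // (w_far_mass (fun t => (1 < t)%N && (t != Q))).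
Qed.

Let sum_ge2_splitQ (F : nat -> R) : \sum_(t < r.+1 | (1 < t)%N) F t =
  F Q + \sum_(t < r.+1 | (1 < t)%N && (t != Q :> nat)) F t.
Proof.
rewrite (bigD1 (inord Q)) /= inordK ?ltnS //; congr (_ + _); apply: eq_bigl => t.
by rewrite -(inj_eq val_inj) /= inordK ?ltnS.
Qed.

(* The weight has total mass zero, so its value at Q is read off the others. *)
Lemma three_node_atQ : `|three_node_weight Q| <= (Q%:R - 1)^-1 + 6 * sigma.
Proof.
have mass0 := annihilates_sum three_node_annihilates.
rewrite (sum_ord_split01 _ r_gt0) sum_ge2_splitQ three_node_at0 in mass0.
set far := \sum_(_ | _) _ in mass0.
have far_le : `|far| <= 2 * sigma.
  exact: le_trans (ler_norm_sum _ _ _) three_node_far_mass.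
have -> : three_node_weight Q = (Q%:R - 1)^-1 -
    (three_node_weight 1 + Q%:R / (Q%:R - 1)) - far.
  have -> : Q%:R / (Q%:R - 1) = 1 + (Q%:R - 1)^-1 :> R by field; rewrite gt_eqF.
  by lra.
apply: le_trans (ler_normB _ _) _; apply: le_trans (lerD (ler_normB _ _) far_le) _.
rewrite gtr0_norm ?invr_gt0 //; move: three_node_near1; lra.
Qed.

Lemma three_node_mass :
  \sum_(t < r.+1 | (1 < t)%N) `|three_node_weight t| <= (Q%:R - 1)^-1 + 8 * sigma.
Proof.
rewrite (sum_ge2_splitQ (fun t => `|three_node_weight t|)).
by have := lerD three_node_atQ three_node_far_mass; lra.
Qed.

Lemma three_node_bounds : 257 <= Q%:R :> R -> sigma <= 1 / 8 / Q%:R ->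
  [/\ `|three_node_weight 1 + 1| <= 1 / 2, `|three_node_weight Q| <= 2 / Q%:R &
      \sum_(t < r.+1 | (1 < t)%N) `|three_node_weight t| <= 1 / 128].
Proof.
move=> Q_ge sigma_le.
have Qinv_le : Q%:R^-1 <= 257^-1 :> R by rewrite lef_pV2 ?posrE; lra.
have Qpred_le : (Q%:R - 1)^-1 <= 257 / 256 / Q%:R :> R.
  rewrite -ler_pdivrMr ?invr_gt0 ?invrK; last lra.
  by rewrite mulrC ler_pdivrMr; lra.
have ratioE : Q%:R / (Q%:R - 1) = 1 + (Q%:R - 1)^-1 :> R by field; rewrite gt_eqF.
have Qpred_ge0 : 0 <= (Q%:R - 1)^-1 :> R by rewrite invr_ge0 ltW.
have near1 := three_node_near1; rewrite ratioE ler_norml in near1.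
split.
- by move/andP: near1 => [? ?]; rewrite ler_norml; apply/andP; split; lra.
- by apply: le_trans three_node_atQ _; lra.
- by apply: le_trans three_node_mass _; lra.
Qed.

End ThreeNodeWeight.

Definition decay_envelope (R : realType) (C beta : R) (t : nat) : R :=
  C / t%:R ^+ 2 * expR (- (t%:R / beta)).

Record light_weight (R : realType) (r d : nat) (env w : nat -> R) : Prop := {
  light_annihilates : annihilates r d.+1 w;
  light_at0 : w 0%N = 1;
  light_at1 : w 1%N <= - (1 / 2);
  light_mass : \sum_(t < r.+1 | (1 < t)%N) `|w t| <= 1 / 128;
  light_le : forall t, (0 < t)%N -> `|w t| <= env t }.

Section LightWeight.
Variable R : realType.
Implicit Types (r m t : nat) (C beta : R).

Lemma decay_envelope_ge0 C beta t : 0 <= C -> 0 <= decay_envelope C beta t.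
Proof. by move=> C0; rewrite mulr_ge0 ?expR_ge0 // divr_ge0 // exprn_ge0. Qed.

Lemma decay_envelopeZ a C beta t :
  a * decay_envelope C beta t = decay_envelope (a * C) beta t.
Proof. by rewrite /decay_envelope !mulrA. Qed.

Lemma decay_envelope_ge C beta t : 0 <= C -> 2 * t%:R <= beta -> 0 < beta ->
  C / t%:R ^+ 2 / 2 <= decay_envelope C beta t.
Proof.
move=> C0 t_beta beta0; rewrite ler_wpM2l ?divr_ge0 ?exprn_ge0 //.
apply: le_trans (expR_ge1Dx _).
have : t%:R / beta <= 1 / 2 by rewrite ler_pdivrMr //; lra.
by lra.
Qed.

Lemma light_weight_delta r C beta : (0 < r)%N -> 2 <= C -> 2 <= beta ->
  light_weight r 0 (decay_envelope C beta) (fun t => (t == 0)%N%:R - (t == 1)%N%:R).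
Proof.
move=> r0 C2 beta2; split=> [p p1|||| t t0] /=.
- rewrite (size1_polyC p1); under eq_bigr do rewrite hornerC mulrBl.
  by rewrite sumrB !(sum_ord_delta (fun=> p`_0)) ?subrr.
- by rewrite subr0.
- by rewrite sub0r; lra.
- by rewrite big1 // => -[[|[|t]] tr] //= _; rewrite subrr normr0.
case: t t0 => [|[|t]] // _ /=; last by rewrite subrr normr0 decay_envelope_ge0 //; lra.
rewrite sub0r normrN1; apply: le_trans (decay_envelope_ge _ _ _); rewrite ?expr1n; lra.
Qed.

(* Q is large to make the mass 1 / (Q - 1) at Q small; the factor 1 / t^2 in    *)
(* the envelope comes from the two added nodes 1 and Q.                         *)
Lemma light_weight_three_node r K M Q beta :
  (256 < Q)%N -> (32 * Q <= K)%N -> (0 < M)%N -> (K * M ^ 2 <= r)%N ->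
  (K * (2 * M).+1)%:R <= beta ->
  light_weight r M (decay_envelope (8 * Q%:R) beta)
    (three_node_weight r Q (square_weight R K M)).
Proof.
move=> Q_gt QK M0 KMr K_beta.
have K0 : (0 < K)%N by lia.
have Q_gt1 : (1 < Q)%N by lia.
have Q_le : (Q <= r)%N by apply: leq_trans KMr; nia.
have wann := @square_weight_annihilates R K M r KMr.
have w0 := square_weight0 R M K0.
have w_gap t : (0 < t < 2 * Q)%N -> square_weight R K M t = 0.
  by move=> tQ; apply: square_weight_gap; lia.
have w_mass := @square_weight_mass R K M r K0 KMr.
have QR : 257 <= Q%:R :> R by rewrite (ler_nat _ 257).
have sigma_le : 4 / K%:R <= 1 / 8 / Q%:R :> R.
  rewrite ler_pdivrMr ?ltr0n // mulrAC ler_pdivlMr; last lra.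
  have : (32 * Q)%:R <= K%:R :> R by rewrite ler_nat.
  by rewrite natrM; lra.
have beta_ge : 2 * Q%:R <= beta.
  by apply: le_trans K_beta; rewrite -natrM ler_nat; nia.
have [w1_near wQ_le w_mass_le] :=
  three_node_bounds Q_gt1 w_gap w0 Q_le wann w_mass QR sigma_le.
split=> [p pM|||//| t t0].
- by apply: (three_node_annihilates Q_gt1 w_gap Q_le wann); exact: leqW.
- exact: three_node_at0.
- by move: w1_near; rewrite ler_norml => /andP[]; lra.
have [->|t1] := eqVneq t 1%N.
  move: w1_near => /(le_trans (lerB_normD _ _)).
  rewrite normr1 => ?; apply: le_trans (decay_envelope_ge _ _ _); rewrite ?expr1n; lra.
have [->|tQ] := eqVneq t Q.
  apply: le_trans wQ_le (le_trans _ (decay_envelope_ge _ _ _)); try lra.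
  have -> : 8 * Q%:R / Q%:R ^+ 2 / 2 = 4 / Q%:R :> R by field; lra.
  by rewrite ler_wpM2r ?invr_ge0 //; lra.
apply: le_trans (three_node_far r Q_gt1 w_gap _ tQ) _; first lia.
rewrite mulrAC (_ : decay_envelope _ _ _ =
  4 * Q%:R / t%:R ^+ 2 * (2 * expR (- (t%:R / beta)))); last first.
  by rewrite /decay_envelope; ring.
rewrite ler_wpM2l ?divr_ge0 ?mulr_ge0 ?exprn_ge0 //.
apply: le_trans (square_weight_le_expR R M K0 t0) _.
have scale_gt0 : 0 < (K * (2 * M).+1)%:R :> R by rewrite ltr0n muln_gt0 K0.
by rewrite ler_pM2l // ler_expR lerN2 ler_wpM2l // lef_pV2 ?posrE // (lt_le_trans scale_gt0).
Qed.

Lemma light_weight_exists m : (0 < m)%N ->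
  exists w : nat -> R,
    light_weight (m ^ 2) (m %/ 128) (decay_envelope (2 ^+ 12) (384 * m)%:R) w.
Proof.
move=> m0.
have [->|M0] := posnP (m %/ 128).
  eexists; apply: light_weight_delta; first by rewrite expn_gt0 m0.
    by rewrite -natrX (ler_nat _ 2).
  by rewrite (ler_nat _ 2); lia.
have Mm : (128 * (m %/ 128) <= m)%N by rewrite mulnC leq_divM.
have QR : (512 : nat)%:R = 2 ^+ 9 :> R by rewrite -natrX.
exists (three_node_weight (m ^ 2) 512 (square_weight R (128 * 128) (m %/ 128))).
rewrite (_ : 2 ^+ 12 = 8 * 512%:R); last by rewrite QR; ring.
apply: light_weight_three_node => //; first by rewrite mulnn -expnMn leq_sqr.
by rewrite ler_nat; nia.
Qed.

End LightWeight.

Record base_pair (R : realType) (r d : nat) (lo hi A B : nat -> R) : Prop := {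
  pair_horner : forall p : {poly R}, (size p <= d.+1)%N ->
    p.[0] + \sum_(t < r.+1) A t * p.[t%:R] = \sum_(t < r.+1) B t * p.[t%:R];
  pair_at0 : A 0%N = 0 /\ B 0%N = 0;
  pair_ge : forall t, (0 < t)%N -> lo t <= A t /\ lo t <= B t;
  pair_le : forall t, (0 < t)%N -> A t <= hi t /\ B t <= hi t;
  pair_dominated : forall t, A t <= 2 * B t;
  pair_mass : \sum_(t < r.+1) A t <= 1 / 32;
  pair_at1 : 1 / 2 <= B 1%N }.

Section BasePair.
Variable R : realType.
Implicit Types (r d m t : nat) (env w : nat -> R).

(* A and B share a geometric summand, which keeps both of them positive at every *)
(* positive node and so later allows mass to be moved around locally.            *)
Lemma base_pair_of_light_weight r d env w :
  (0 < r)%N -> light_weight r d env w ->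
  (forall t, (0 < t)%N -> geometric (1 / 64) (1 / 4) t <= env t) ->
  exists A B, base_pair r d (geometric (1 / 64) (1 / 4)) (fun t => 3 * env t) A B.
Proof.
move=> r0 [wann w0 w1 wmass wle] geom_env.
pose rho t : R := geometric (1 / 64) (1 / 4) t.
have rho_gt0 t : 0 < rho t by rewrite /rho /= mulr_gt0 // ?exprn_gt0 //; lra.
have rho_sum : \sum_(t < r) rho t.+1 <= 1 / 64.
  rewrite (eq_bigr (fun t : 'I_r => geometric (1 / 256) (1 / 4) t)); last first.
    by move=> t _; rewrite /rho /= exprS mulrA; congr (_ * _); lra.
  rewrite -(big_mkord predT (geometric (1 / 256) (1 / 4))).
  apply: le_trans (geometric_le_lim _ _ _ _) _; rewrite ?ger0_norm; try lra.
  by rewrite (_ : 1 - 1 / 4 = 3 / 4); [rewrite invf_div|]; lra.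
exists (fun t => if t == 0%N then 0 else `|w t| + w t + rho t).
exists (fun t => if t == 0%N then 0 else `|w t| + rho t).
split=> //.
- move=> p pd; apply/eqP; rewrite -subr_eq0 -addrA -sumrB; apply/eqP.
  rewrite -[RHS](wann p pd) [RHS]big_ord_recl big_ord_recl /= w0 mul1r !mul0r subrr add0r.
  by congr (_ + _); apply: eq_bigr => t _; rewrite -mulrBl; congr (_ * _); ring.
- move=> t t0; rewrite gtn_eqF // !lerDr normr_ge0; split=> //.
  by have := lerNnormlW (lexx `|w t|); lra.
- move=> t t0; rewrite gtn_eqF //; have := wle t t0; have := geom_env t t0.
  by rewrite -/(rho t); have := ler_norm (w t); have := normr_ge0 (w t); split; lra.
- move=> t; case: eqP => // _.
  by have := rho_gt0 t; have := ler_norm (w t); have := normr_ge0 (w t); lra.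
- rewrite big_ord_recl /= add0r.
  apply: (@le_trans _ _ (2 * \sum_(t < r.+1 | (1 < t)%N) `|w t| + \sum_(t < r) rho t.+1));
    last lra.
  rewrite big_split /= lerD2r mulr_sumr [X in _ <= X]big_mkcond [X in _ <= X]big_ord_recl /=.
  rewrite add0r; apply: ler_sum => -[[|i] ir] _ /=; first by rewrite ler0_norm ?addNr; lra.
  by rewrite mulr_natl mulr2n lerD2l ler_norm.
- by rewrite /= ler0_norm; [have := rho_gt0 1%N; rewrite /rho /=|]; lra.
Qed.

Lemma leq_sqr_expn2 t : (t ^ 2 <= 2 * 2 ^ t)%N.
Proof.
elim: t => // t IH; case: (leqP t 2) => [|t3]; first by case: t {IH} => [|[|[|]]].
by rewrite [X in (_ <= _ * X)%N]expnS; apply: (@leq_trans (2 * t ^ 2)); nia.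
Qed.

Lemma geometric_le_decay (C beta : R) t : 1 <= C -> 2 <= beta -> (0 < t)%N ->
  geometric (1 / 64) (1 / 4) t <= decay_envelope C beta t :> R.
Proof.
move=> C1 beta2 t0; rewrite /geometric /=.
have sqr_le : t%:R ^+ 2 <= 2 * 2 ^+ t :> R.
  by rewrite -!natrX -natrM ler_nat leq_sqr_expn2.
have exp_ge : (1 / 2) ^+ t <= expR (- (t%:R / beta)) :> R.
  rewrite [t%:R / _]mulrC -mulNr expRM_natr; apply: lerXn2r; rewrite ?nnegrE ?expR_ge0 //;
    try lra.
  apply: le_trans (expR_ge1Dx _).
  by have : beta^-1 <= 2^-1 by [rewrite lef_pV2 ?posrE; lra]; lra.
have -> : (1 / 4) ^+ t = (1 / 2) ^+ t * (1 / 2) ^+ t :> R.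
  by rewrite -exprMn; congr (_ ^+ t); lra.
rewrite /decay_envelope mulrA ler_pM ?mulr_ge0 ?exprn_ge0 //; try lra.
rewrite ler_pdivlMr ?exprn_gt0 ?ltr0n //.
apply: le_trans (ler_wpM2l _ sqr_le) _; first by rewrite mulr_ge0 ?exprn_ge0; lra.
rewrite mulrACA -exprMn.
by rewrite (_ : 1 / 2 * 2 = 1) ?expr1n; lra.
Qed.

End BasePair.

(** * Moments and movable mass on a grid *)

Lemma ltn_sum_exists (I : finType) (P : pred I) (e a : I -> nat) :
  (\sum_(i | P i) e i < \sum_(i | P i) a i)%N -> exists2 i, P i & (e i < a i)%N.
Proof.
case: (pickP (fun i => P i && (e i < a i)%N)) => [i /andP[Pi ei] _|none]; first by exists i.
rewrite ltnNge leq_sum // => i Pi.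
by have := none i; rewrite Pi /= ltnNge => /negbFE.
Qed.

Section Moments.
Variables (R : comNzRingType) (I : finType) (r : nat).
Local Notation point := {ffun I -> 'I_r.+1}.
Implicit Types (L : point -> R) (F G : I -> nat -> R) (e : I -> nat) (D : nat).

Definition monomial e (y : point) : R := \prod_i (y i)%:R ^+ e i.

Definition moment L e : R := \sum_y L y * monomial e y.

Definition same_moments D L L' : Prop :=
  forall e, (\sum_i e i <= D)%N -> moment L e = moment L' e.

Definition tensor (F : nat -> R) (y : point) : R := \prod_i F (y i).

Lemma moment_prod F e : moment (fun y => \prod_i F i (y i)) e =
  \prod_i \sum_(t < r.+1) F i t * t%:R ^+ e i.
Proof.
by rewrite bigA_distr_bigA; apply: eq_bigr => y _; rewrite -big_split.
Qed.

Lemma momentB L L' e : moment (fun y => L y - L' y) e = moment L e - moment L' e.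
Proof. by rewrite -sumrB; apply: eq_bigr => y _; rewrite mulrBl. Qed.

Lemma momentMr c L e : moment (fun y => L y * c) e = moment L e * c.
Proof. by rewrite mulr_suml; apply: eq_bigr => y _; rewrite mulrAC. Qed.

Lemma moment_sum (J : finType) (P : pred J) (L : J -> point -> R) e :
  moment (fun y => \sum_(j | P j) L j y) e = \sum_(j | P j) moment (L j) e.
Proof. by rewrite exchange_big; apply: eq_bigr => y _; rewrite mulr_suml. Qed.

Lemma moment_mass L : moment L (fun=> 0%N) = \sum_y L y.
Proof. by apply: eq_bigr => y _; rewrite /monomial big1 ?mulr1. Qed.

Lemma same_moments_mass D L L' : same_moments D L L' -> \sum_y L y = \sum_y L' y.
Proof. by move=> LL'; rewrite -!moment_mass LL' // big1. Qed.

Lemma same_momentsB D L1 L2 L1' L2' :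
  same_moments D L1 L1' -> same_moments D L2 L2' ->
  same_moments D (fun y => L1 y - L2 y) (fun y => L1' y - L2' y).
Proof. by move=> LL1 LL2 e eD; rewrite !momentB LL1 ?LL2. Qed.

End Moments.

(* Mass can be moved from y to x, which differ only on S and have the same      *)
(* zeros, at the price of the factor prod_S hi(y_i) / lo(x_i).                  *)
Definition movable (R : realDomainType) (I : finType) (r : nat) (lo hi : nat -> R)
    (L : {ffun I -> 'I_r.+1} -> R) : Prop :=
  forall (S : {set I}) (x y : {ffun I -> 'I_r.+1}),
    (forall i, i \notin S -> x i = y i) ->
    (forall i, i \in S -> (0 < x i)%N /\ (0 < y i)%N) ->
    L y * \prod_(i in S) lo (x i) <= L x * \prod_(i in S) hi (y i).

Section Movable.
Variables (R : realFieldType) (I : finType) (r : nat) (lo hi : nat -> R).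
Local Notation point := {ffun I -> 'I_r.+1}.
Implicit Types (F L : point -> R) (S : {set I}) (x y : point).
Hypothesis lo_ge0 : forall t, (0 < t)%N -> 0 <= lo t.
Hypothesis hi_ge0 : forall t, (0 < t)%N -> 0 <= hi t.

Let prod_lo_ge0 S x : (forall i, i \in S -> (0 < x i)%N) -> 0 <= \prod_(i in S) lo (x i).
Proof. by move=> pos; apply: prodr_ge0 => i /pos; exact: lo_ge0. Qed.

Let prod_hi_ge0 S y : (forall i, i \in S -> (0 < y i)%N) -> 0 <= \prod_(i in S) hi (y i).
Proof. by move=> pos; apply: prodr_ge0 => i /pos; exact: hi_ge0. Qed.

Lemma movable_tensor (f : nat -> R) :
  (forall t, 0 <= f t) -> (forall t, (0 < t)%N -> lo t <= f t) ->
  (forall t, (0 < t)%N -> f t <= hi t) ->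
  movable lo hi (tensor f : point -> R).
Proof.
move=> f_ge0 lo_f f_hi S x y xy pos; rewrite /tensor.
rewrite [\prod_(i in S) lo _]big_mkcond [\prod_(i in S) hi _]big_mkcond.
rewrite -!big_split /=; apply: ler_prod => i _; case: ifP => iS; last first.
  by rewrite !mulr1 f_ge0 xy ?iS /=.
have [x0 y0] := pos i iS.
by rewrite mulr_ge0 ?lo_ge0 //= [X in _ <= X]mulrC ler_pM ?lo_ge0 ?lo_f ?f_hi.
Qed.

Lemma movable_restrict (P : pred point) L :
  (forall x y, (forall i, (x i == 0 :> nat)%N = (y i == 0 :> nat)%N) -> P x = P y) ->
  movable lo hi L -> movable lo hi (fun y => if P y then L y else 0).
Proof.
move=> P_zeros L_mov S x y xy pos; rewrite (P_zeros x y).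
  by case: ifP => _; [exact: L_mov|rewrite !mul0r].
move=> i; have [/pos[x0 y0]|/xy -> //] := boolP (i \in S).
by rewrite !gtn_eqF.
Qed.

Lemma movableMr c L : 0 <= c -> movable lo hi L -> movable lo hi (fun y => L y * c).
Proof.
by move=> c_ge0 L_mov S x y xy pos; rewrite mulrAC [X in _ <= X]mulrAC ler_wpM2r // L_mov.
Qed.

Lemma movable_comparable (a k : R) F L : 1 <= k -> (forall y, 0 <= L y) ->
  (forall y, a * F y <= L y) -> (forall y, L y <= k * (a * F y)) -> 0 <= a ->
  movable lo hi F -> movable lo (fun t => k * hi t) L.
Proof.
move=> k_ge1 L_ge0 F_le_L L_le_F a_ge0 F_mov S x y xy pos.
have k_ge0 : 0 <= k by exact: le_trans ler01 k_ge1.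
have hiS : 0 <= \prod_(i in S) hi (y i) by apply: prod_hi_ge0 => i /pos[].
have loS : 0 <= \prod_(i in S) lo (x i) by apply: prod_lo_ge0 => i /pos[].
have [S0|[j jS]] := set_0Vmem S.
  by rewrite S0 !big_set0 !mulr1 (_ : x = y) //; apply/ffunP => i; rewrite xy // S0 inE.
rewrite big_split prodr_const /=.
apply: le_trans (ler_wpM2r loS (L_le_F y)) _.
apply: (@le_trans _ _ (k * (L x * \prod_(i in S) hi (y i)))).
  rewrite -mulrA ler_wpM2l // -mulrA; apply: le_trans (ler_wpM2l a_ge0 (F_mov S x y xy pos)) _.
  by rewrite mulrA ler_wpM2r.
rewrite mulrCA ler_wpM2l // ler_wpM2r // -[X in X <= _]expr1; apply: ler_weXn2l => //.
by apply/card_gt0P; exists j.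
Qed.

End Movable.

Definition dual_pair (R : realType) (I : finType) (r d : nat) (lo hi : nat -> R)
    (g : {ffun I -> 'I_r.+1} -> bool) (L : bool -> {ffun I -> 'I_r.+1} -> R) : Prop :=
  [/\ forall b y, 0 <= L b y, forall b, \sum_y L b y = 1,
      forall b y, L b y != 0 -> g y = b, forall b, movable lo hi (L b) &
      same_moments d (L true) (L false)].

Lemma dual_pair_negb (R : realType) (I : finType) (r d : nat) (lo hi : nat -> R)
    (g : {ffun I -> 'I_r.+1} -> bool) (L : bool -> {ffun I -> 'I_r.+1} -> R) :
  dual_pair d lo hi g L -> dual_pair d lo hi (fun y => ~~ g y) (fun b => L (~~ b)).
Proof.
move=> [L0 L1 Lg Lmov Lsame]; split=> // [b y /Lg ->|e ed]; first by rewrite negbK.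
by rewrite Lsame.
Qed.

Section BlockDual.
Variables (R : realType) (I : finType) (r d : nat) (lo hi A B : nat -> R).
Local Notation point := {ffun I -> 'I_r.+1}.
Implicit Types (S : {set I}) (y : point) (t : nat).
Hypothesis AB : base_pair r d lo hi A B.
Hypotheses (r_gt0 : (0 < r)%N) (I_gt0 : (0 < #|I|)%N) (d_le : (2 * d <= #|I|)%N).
Hypothesis lo_ge0 : forall t, (0 < t)%N -> 0 <= lo t.

Let a := \sum_(t < r.+1) A t.

Let A_ge0 t : 0 <= A t.
Proof.
case: t => [|t]; first by rewrite (pair_at0 AB).1.
exact: le_trans (lo_ge0 _) (pair_ge AB _).1.
Qed.

Let B_ge0 t : 0 <= B t.
Proof.
case: t => [|t]; first by rewrite (pair_at0 AB).2.
exact: le_trans (lo_ge0 _) (pair_ge AB _).2.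
Qed.

Let hi_ge0 t : (0 < t)%N -> 0 <= hi t.
Proof. by move=> /(pair_le AB)[A_hi _]; exact: le_trans A_hi. Qed.

Let a_ge0 : 0 <= a. Proof. exact: sumr_ge0. Qed.

Let tensorB_ge0 y : 0 <= tensor B y.
Proof. exact: prodr_ge0. Qed.

(* Every factor A - a delta_1 annihilates constants, so the terms of the        *)
(* expansion of the power of A = (A - a delta_1) + a delta_1 with more than d   *)
(* such factors do not contribute to the moments of degree at most d.           *)
Definition light_factor (centered : bool) t : R :=
  if centered then A t - a * (t == 1)%N%:R else a * (t == 1)%N%:R.

Definition light_term S y : R := \prod_i light_factor (i \in S) (y i).

Definition light_correction y : R := \sum_(S : {set I} | (#|S| <= d)%N) light_term S y.

Definition zero_or_light t : R := (t == 0)%N%:R + A t.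

Definition block_measure (b : bool) y : R :=
  if b then tensor B y - light_correction y else tensor zero_or_light y - tensor A y.

Let sum_light_term y : \sum_(S : {set I}) light_term S y = tensor A y.
Proof.
transitivity (\prod_i (light_factor true (y i) + light_factor false (y i))).
  rewrite (@bigA_distr R 0 1); apply: eq_bigr => S _; apply: eq_bigr => i _.
  by case: (i \in S).
by apply: eq_bigr => i _; rewrite /light_factor subrK.
Qed.

Lemma light_correction_moments : same_moments d light_correction (tensor A).
Proof.
move=> e ed; rewrite moment_sum.
transitivity (\sum_(S : {set I}) moment (light_term S) e); last first.
  by rewrite -moment_sum; apply: eq_bigr => y _; rewrite sum_light_term.
rewrite [RHS](bigID (fun S => (#|S| <= d)%N)) /= [X in _ = _ + X]big1 ?addr0 // => S.
rewrite -ltnNge => dS.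
have [|i /= iS] := @ltn_sum_exists I (fun i => i \in S) e (fun=> 1%N).
  rewrite sum1_card (leq_ltn_trans _ dS) // (leq_trans _ ed) //.
  by rewrite [X in (_ <= X)%N](bigID (mem S)) leq_addr.
rewrite ltnS leqn0 => /eqP ei.
rewrite (moment_prod _ (fun i => light_factor (i \in S))) (bigD1 i) //= iS ei /light_factor.
under eq_bigr do rewrite expr0 mulr1 [a * _]mulrC.
by rewrite sumrB (sum_ord_delta (fun=> a)) // subrr mul0r.
Qed.

Lemma block_measure_moments : same_moments d (block_measure true) (block_measure false).
Proof.
apply: same_momentsB; last exact: light_correction_moments.
move=> e ed; rewrite (moment_prod _ (fun=> B)) (moment_prod _ (fun=> zero_or_light)).
apply: eq_bigr => i _.
have := pair_horner AB (p := 'X^(e i)); rewrite size_polyXn ltnS.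
have -> : (e i <= d)%N by apply: leq_trans ed; rewrite (bigD1 i) //= leq_addr.
move=> /(_ isT); rewrite hornerXn; under eq_bigr do rewrite hornerXn.
under [X in _ = X]eq_bigr do rewrite hornerXn.
move=> <-; under [RHS]eq_bigr do rewrite mulrDl.
by rewrite big_split /= (sum_ord_delta (fun t => t%:R ^+ e i)).
Qed.

Let light_factor_le (centered : bool) t :
  `|light_factor centered t| <= (if centered then 2 else 2 * a) * B t.
Proof.
have delta_le : a * (t == 1)%N%:R <= 2 * a * B t.
  case: eqP => [->|_]; last by rewrite mulr0 !mulr_ge0.
  by rewrite mulr1; have := ler_wpM2l a_ge0 (pair_at1 AB); lra.
rewrite /light_factor; case: centered; last by rewrite ger0_norm // mulr_ge0.
have := pair_dominated AB t; have := A_ge0 t.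
have [t1|t1] := eqVneq t 1%N; last by rewrite mulr0 subr0 => *; rewrite ger0_norm.
move: delta_le; rewrite t1 /= mulr1 => delta_le A1_ge A1_le.
have A1_le_a : A 1 <= a.
  by rewrite /a (bigD1 (inord 1)) //= inordK ?ltnS // lerDl sumr_ge0.
have := pair_mass AB; have := pair_at1 AB; rewrite -/a ler_norml => *.
by apply/andP; split; lra.
Qed.

Let light_term_le S y :
  `|light_term S y| <= 2 ^+ #|S| * (2 * a) ^+ (#|I| - #|S|) * tensor B y.
Proof.
rewrite /light_term normr_prod.
apply: (@le_trans _ _ (\prod_i ((if i \in S then 2 else 2 * a) * B (y i)))).
  by apply: ler_prod => i _; rewrite normr_ge0 light_factor_le.
rewrite big_split (ler_wpM2r (tensorB_ge0 y)) // (bigID (mem S)) /=.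
rewrite (eq_bigr (fun=> 2)) => [|i iS]; last by rewrite iS.
rewrite [X in _ * X](eq_bigr (fun=> 2 * a)) => [|i iS]; last by rewrite (negbTE iS).
rewrite !prodr_const -(cardsC S) addKn (_ : #|[predC mem S]| = #|~: S|) //.
by apply: eq_card => i; rewrite !inE.
Qed.

Lemma light_correction_le y : `|light_correction y| <= 1 / 2 * tensor B y.
Proof.
have a_le : 2 * a <= 1 / 16 by have := pair_mass AB; rewrite -/a; lra.
have a2_ge0 : 0 <= 2 * a by rewrite mulr_ge0.
apply: le_trans (ler_norm_sum _ _ _) _.
apply: (@le_trans _ _ (\sum_(S : {set I}) 2 ^+ d * (1 / 16) ^+ (#|I| - d) * tensor B y)).
  rewrite big_mkcond; apply: ler_sum => S _; case: ifP => Sd; last first.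
    by rewrite !mulr_ge0 // exprn_ge0 //; lra.
  apply: le_trans (light_term_le S y) _; rewrite ler_wpM2r //.
  apply: ler_pM; rewrite ?exprn_ge0 //; first by rewrite ler_weXn2l //; lra.
  apply: le_trans (_ : (1 / 16) ^+ (#|I| - #|S|) <= _).
    by apply: lerXn2r; rewrite ?nnegrE; lra.
  by apply: ler_wiXn2l; [lra|lra|exact: leq_sub2l].
rewrite sumr_const -mulrnAl ler_wpM2r //.
have -> : #|{: {set I}}| = (2 ^ #|I|)%N.
  by rewrite -[LHS]cardsT -powersetT card_powerset cardsT.
rewrite -mulr_natr natrX.
have -> : (1 / 16) ^+ (#|I| - d) = (1 / 2) ^+ (4 * (#|I| - d)) :> R.
  by rewrite exprM; congr (_ ^+ _); lra.
apply: (@le_trans _ _ (2 ^+ d * (1 / 2) ^+ (d + #|I|).+1 * 2 ^+ #|I|)).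
  rewrite ler_wpM2r ?exprn_ge0 // ler_wpM2l ?exprn_ge0 // ler_wiXn2l; [|lra|lra|]; lia.
rewrite mulrAC -exprD exprS mulrCA -exprMn (_ : 2 * (1 / 2) = 1) ?expr1n; lra.
Qed.

Let tensorB_le y : 1 / 2 * tensor B y <= block_measure true y.
Proof. by have := le_trans (ler_norm _) (light_correction_le y); rewrite /=; lra. Qed.

Let le_tensorB y : block_measure true y <= 3 * (1 / 2 * tensor B y).
Proof. by have := light_correction_le y; rewrite ler_norml /= => /andP[]; lra. Qed.

Let tensor_eq0 (F : nat -> R) y i : F 0%N = 0 -> y i = 0%N :> nat -> tensor F y = 0.
Proof. by move=> F0 yi; rewrite /tensor (bigD1 i) //= yi F0 mul0r. Qed.

Lemma block_measure_falseE y : block_measure false y =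
  if ~~ [forall i, (0 < y i)%N] then tensor zero_or_light y else 0.
Proof.
rewrite /block_measure; case: ifPn => [|/negbNE/forallP pos].
  rewrite negb_forall => /existsP[i]; rewrite -leqNgt leqn0 => /eqP yi.
  by rewrite (tensor_eq0 (pair_at0 AB).1 yi) subr0.
apply/eqP; rewrite subr_eq0; apply/eqP/eq_bigr => i _.
by rewrite /zero_or_light gtn_eqF // add0r.
Qed.

Lemma block_measure_ge0 b y : 0 <= block_measure b y.
Proof.
case: b; first by apply: le_trans (tensorB_le y); rewrite mulr_ge0.
rewrite block_measure_falseE; case: ifP => // _.
by apply: prodr_ge0 => i _; rewrite addr_ge0.
Qed.

Lemma block_measure_neq0 b y : block_measure b y != 0 -> [forall i, (0 < y i)%N] = b.
Proof.
case: b; last by rewrite block_measure_falseE; case: ifPn => [/negbTE -> //|_]; rewrite eqxx.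
move=> mu_neq0; apply/forallP => i; rewrite lt0n; apply: contra mu_neq0 => /eqP yi.
rewrite eq_le block_measure_ge0 andbT; apply: le_trans (le_tensorB y) _.
by rewrite (tensor_eq0 (pair_at0 AB).2 yi) !mulr0.
Qed.

Lemma block_measure_movable b : movable lo (fun t => 3 * hi t) (block_measure b).
Proof.
case: b.
  apply: (movable_comparable lo_ge0 hi_ge0 _ (block_measure_ge0 true) tensorB_le le_tensorB).
  - by lra.
  - by lra.
  by apply: movable_tensor => // t t0; [have [] := pair_ge AB t0|have [] := pair_le AB t0].
have -> : block_measure false =
    (fun y => if ~~ [forall i, (0 < y i)%N] then tensor zero_or_light y else 0).
  by apply/funext => y; exact: block_measure_falseE.
apply: movable_restrict => [x y xy|].
  by congr (~~ _); apply: eq_forallb => i; rewrite !lt0n xy.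
apply: movable_tensor => // t => [|t0|t0]; rewrite /zero_or_light; first by rewrite addr_ge0.
  by rewrite gtn_eqF // add0r; have [] := pair_ge AB t0.
rewrite gtn_eqF // add0r; have [A_le _] := pair_le AB t0.
by apply: le_trans A_le _; have := hi_ge0 t0; lra.
Qed.

Lemma block_measure_mass_gt0 : 0 < \sum_y block_measure true y.
Proof.
rewrite (bigD1 [ffun=> inord 1]) // ltr_wpDr //.
  by apply: sumr_ge0 => y _; exact: block_measure_ge0.
apply: lt_le_trans (tensorB_le _); apply: mulr_gt0; first by lra.
apply: prodr_gt0 => i _; rewrite ffunE inordK ?ltnS //.
by have := pair_at1 AB; lra.
Qed.

Lemma block_dual_pair : dual_pair d lo (fun t => 3 * hi t)
  (fun y => [forall i, (0 < y i)%N])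
  (fun b y => block_measure b y / \sum_y block_measure true y).
Proof.
have mass_gt0 := block_measure_mass_gt0.
have massE b : \sum_y block_measure b y = \sum_y block_measure true y.
  by case: b => //; rewrite (same_moments_mass block_measure_moments).
split.
- by move=> b y; rewrite divr_ge0 ?block_measure_ge0 // ltW.
- by move=> b; rewrite -mulr_suml massE divff // gt_eqF.
- by move=> b y; rewrite mulf_eq0 negb_or => /andP[/block_measure_neq0].
- by move=> b; apply: movableMr (block_measure_movable b); rewrite invr_ge0 ltW.
by move=> e ed; rewrite !momentMr block_measure_moments.
Qed.

End BlockDual.

(** * Truncation to small weight *)

(* With T = t - 1 and b = x - 1, this is the coefficient of f(1 + b) in the    *)
(* order-a term 'C(T, a) Delta^a f(1) of Newton's forward formula for f(1 + T).*)
Definition newton_kernel (R : pzRingType) (a t x : nat) : R :=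
  if x is b.+1 then 'C(t.-1, a)%:R * ((-1) ^+ (a - b) * 'C(a, b)%:R) else 0.

Lemma coef_Xsub1_exp (R : comNzRingType) (a b : nat) :
  (('X - 1 : {poly R}) ^+ a)`_b = (-1) ^+ (a - b) * 'C(a, b)%:R.
Proof.
rewrite addrC exprDn coef_sum.
transitivity (\sum_(i < a.+1) (i == b :> nat)%:R * ((-1) ^+ (a - i) * 'C(a, i)%:R) : R).
  apply: eq_bigr => i _; rewrite coefMn (_ : (-1) ^+ (a - i) = ((-1) ^+ (a - i))%:P).
    by rewrite coefCM coefXn eq_sym -mulr_natr; ring.
  by rewrite rmorphXn rmorphN rmorph1.
have [ba|ab] := leqP b a; first by rewrite (sum_ord_delta
  (fun i => (-1) ^+ (a - i) * 'C(a, i)%:R)).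
rewrite bin_small // mulr0 big1 // => i _; rewrite ltn_eqF ?mul0r //.
exact: leq_trans (ltn_ord i) ab.
Qed.

Lemma sum_ord_widen0 (V : nmodType) (m n : nat) (F : nat -> V) : (m <= n)%N ->
  (forall i, (m <= i)%N -> F i = 0) -> \sum_(i < n) F i = \sum_(i < m) F i.
Proof.
move=> mn F0; rewrite (big_ord_widen _ _ mn) [RHS]big_mkcond; apply: eq_bigr => i _.
by case: ltnP => // /F0.
Qed.

Section NewtonKernel.
Variable R : realType.

Lemma sum_newton_kernel (r t x : nat) : (0 < t <= r)%N ->
  \sum_(a < r.+1) newton_kernel R a t x = (t == x)%:R.
Proof.
case: t => // t tr; case: x => [|b] /=; first by rewrite big1.
under eq_bigr do rewrite -coef_Xsub1_exp.
rewrite (sum_ord_widen0 (m := t.+1)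
  (F := fun a => 'C(t, a)%:R * (('X - 1 : {poly R}) ^+ a)`_b)).
- have <- : (('X : {poly R}) ^+ t)`_b = (t.+1 == b.+1)%:R by rewrite coefXn eqSS eq_sym.
  rewrite -[in RHS](subrK 1 'X) [in RHS](addrC _ 1) exprDn coef_sum; apply: eq_bigr => a _.
  by rewrite expr1n mul1r coefMn mulr_natl.
- exact: ltnW.
by move=> a ta; rewrite bin_small // mul0r.
Qed.

Lemma newton_kernel_moment_eq0 (r a t e : nat) : (t <= r)%N -> (e < a)%N ->
  \sum_(x < r.+1) newton_kernel R a t x * x%:R ^+ e = 0.
Proof.
move=> tr ea; rewrite big_ord_recl mul0r add0r.
have [at1|ta] := leqP a t.-1; last first.
  by rewrite big1 // => b _; rewrite lift0 /= bin_small // !mul0r.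
under eq_bigr do rewrite lift0.
rewrite (sum_ord_widen0 (m := a.+1) (F := fun b => newton_kernel R a t b.+1 * b.+1%:R ^+ e)).
- have /= := finite_difference_eq0 1 (_ : size ('X^e : {poly R}) <= a)%N.
  rewrite size_polyXn => /(_ ea) diff0.
  rewrite -[RHS](mulr0 ('C(t.-1, a)%:R * (-1) ^+ a)) -[X in _ = _ * X]diff0 mulr_sumr.
  apply: eq_bigr => b _; rewrite hornerXn /= natr1.
  have -> : (-1) ^+ (a - b) = (-1) ^+ a * (-1) ^+ b :> R.
    by rewrite -exprD -signr_odd oddB -?oddD ?signr_odd // -ltnS ltn_ord.
  by ring.
- by move: tr ea at1; lia.
by move=> b ab; rewrite /= (bin_small ab) !mulr0 mul0r.
Qed.

Lemma newton_kernel_le (a t x : nat) : `|newton_kernel R a t x| <= 'C(t.-1, a)%:R * 2 ^+ a.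
Proof.
case: x => [|b] /=; first by rewrite normr0 mulr_ge0 // exprn_ge0.
rewrite !normrM !normr_nat normr_sign mul1r ler_wpM2l // -natrX ler_nat.
have [ba|ab] := leqP b a; last by rewrite bin_small.
rewrite -[2%N]/(1 + 1)%N expnDn (bigD1 (inord b)) //= inordK ?ltnS //.
by rewrite !exp1n !mul1n muln1 leq_addr.
Qed.

Lemma sum_newton_kernel_le_expR (r t x : nat) (z : R) : 0 <= z ->
  \sum_(a < r.+1) `|newton_kernel R a t x| * z ^+ a <= expR (2 * z * t%:R).
Proof.
move=> z_ge0; have z2_ge0 : 0 <= 2 * z by rewrite mulr_ge0.
pose term (a : nat) : R := (2 * z) ^+ a *+ 'C(t.-1, a).
have term_ge0 a : 0 <= term a by rewrite mulrn_wge0 // exprn_ge0.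
apply: (@le_trans _ _ (\sum_(a < r.+1 + t) term a)).
  rewrite big_split_ord /= -[X in X <= _]addr0 lerD ?sumr_ge0 //.
  apply: ler_sum => a _; rewrite /term exprMn -mulr_natl mulrA.
  by rewrite ler_wpM2r ?exprn_ge0 // newton_kernel_le.
rewrite (sum_ord_widen0 (m := t.-1.+1)); [|lia|by move=> a ta; rewrite /term bin_small].
have -> : \sum_(a < t.-1.+1) term a = (1 + 2 * z) ^+ t.-1.
  by rewrite exprDn; apply: eq_bigr => a _; rewrite expr1n mul1r.
rewrite expRM_natr; apply: (@le_trans _ _ (expR (2 * z) ^+ t.-1)).
  by apply: lerXn2r; rewrite ?nnegrE ?addr_ge0 ?expR_ge0 // expR_ge1Dx.
apply: ler_weXn2l; last exact: leq_pred.
by rewrite -[X in X <= _]expR0 ler_expR.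
Qed.

Definition site_kernel (moving : bool) (a t x : nat) : R :=
  if moving then newton_kernel R a t x else (a == 0)%N%:R * (t == x)%:R.

Lemma sum_site_kernel (moving : bool) (r t x : nat) :
  (moving ==> (0 < t))%N -> (t <= r)%N ->
  \sum_(a < r.+1) site_kernel moving a t x = (t == x)%:R.
Proof.
case: moving => /= [t0|_] tr; first by rewrite sum_newton_kernel // t0.
by rewrite (sum_ord_delta (fun=> (t == x)%:R)).
Qed.

Lemma site_kernel_moment_eq0 (moving : bool) (r a t e : nat) :
  (t <= r)%N -> (e < a)%N -> \sum_(x < r.+1) site_kernel moving a t x * x%:R ^+ e = 0.
Proof.
case: moving => tr ea; first exact: newton_kernel_moment_eq0.
by rewrite big1 // => x _; rewrite /site_kernel gtn_eqF ?mul0r //; case: a ea.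
Qed.

End NewtonKernel.

Section Correction.
Variables (R : realType) (I : finType) (r D : nat).
Local Notation point := {ffun I -> 'I_r.+1}.
Implicit Types (S : {set I}) (x y al : point) (e : I -> nat).

Definition correction S y x : R :=
  \sum_(al : point | (\sum_i al i <= D)%N) \prod_i site_kernel R (i \in S) (al i) (y i) (x i).

Lemma correction_moment S y e : (forall i, i \in S -> (0 < y i)%N) ->
  (\sum_i e i <= D)%N -> moment (correction S y) e = monomial R e y.
Proof.
move=> y_gt0 eD; rewrite moment_sum.
pose order_moment al := moment (fun x => \prod_i site_kernel R (i \in S) (al i) (y i) (x i)) e.
have order_momentE al : order_moment al =
    \prod_i \sum_(t < r.+1) site_kernel R (i \in S) (al i) (y i) t * t%:R ^+ e i.
  by rewrite /order_moment (moment_prod _ (fun i => site_kernel R (i \in S) (al i) (y i))).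
have y_le i : (y i <= r)%N by rewrite -ltnS.
transitivity (\sum_(al : point) order_moment al).
  rewrite [RHS](bigID (fun al : point => (\sum_i al i <= D)%N)) /=.
  rewrite [X in _ = _ + X]big1 ?addr0 // => al; rewrite -ltnNge => al_gtD.
  have [i _ ei] := ltn_sum_exists (leq_ltn_trans eD al_gtD).
  by rewrite order_momentE (bigD1 i) //= site_kernel_moment_eq0 ?mul0r.
under eq_bigr do rewrite order_momentE.
rewrite -(bigA_distr_bigA (fun i (a : 'I_r.+1) => \sum_(t < r.+1)
  site_kernel R (i \in S) a (y i) t * t%:R ^+ e i)).
apply: eq_bigr => i _; rewrite exchange_big /=.
rewrite -[RHS](sum_ord_delta (fun t => t%:R ^+ e i) (y_le i)).
apply: eq_bigr => t _; rewrite -mulr_suml sum_site_kernel //; first by rewrite eq_sym.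
by apply/implyP => /y_gt0.
Qed.

Lemma correction_neq0 S y x : correction S y x != 0 ->
  [/\ forall i, i \notin S -> x i = y i, forall i, i \in S -> (0 < x i)%N &
      (\sum_(i in S) x i <= #|S| + D)%N].
Proof.
move=> corr_neq0.
have [al alD kernel_neq0] : exists2 al : point, (\sum_i al i <= D)%N &
    forall i, site_kernel R (i \in S) (al i) (y i) (x i) != 0.
  case: (pickP (fun al : point => (\sum_i al i <= D)%N &&
    [forall i, site_kernel R (i \in S) (al i) (y i) (x i) != 0])) => [al|none].
    by case/andP=> alD /forallP; exists al.
  move: corr_neq0; rewrite /correction big1 ?eqxx // => al alD.
  have := none al; rewrite alD /= => /negbT; rewrite negb_forall => /existsP[i].
  by rewrite negbK => /eqP kernel0; rewrite (bigD1 i) //= kernel0 mul0r.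
have x_onS i : i \in S -> (0 < x i <= (al i).+1)%N.
  move=> iS; have := kernel_neq0 i; rewrite iS /= /newton_kernel.
  case: (x i : nat) => [|b] /=; first by rewrite eqxx.
  by rewrite !mulf_eq0 !negb_or => /and3P[_ _]; rewrite pnatr_eq0 -lt0n bin_gt0.
split=> [i iS|i /x_onS/andP[] //|].
  have := kernel_neq0 i; rewrite (negbTE iS) /site_kernel mulf_eq0 negb_or.
  by move=> /andP[_]; rewrite pnatr_eq0 eqb0 negbK => /eqP yx; apply/val_inj/esym.
apply: (@leq_trans (\sum_(i in S) 1 + \sum_(i in S) al i)).
  by rewrite -big_split /=; apply: leq_sum => i /x_onS /andP[_]; rewrite add1n.
by rewrite sum1_card leq_add2l (leq_trans _ alD) // [leqRHS](bigID (mem S)) leq_addr.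
Qed.

(* Weighting each order a by z^a <= 1 turns the constraint on the total order   *)
(* into the factor z^-D, after which the sum over orders factorizes.            *)
Lemma correction_le S y x (z : R) : 0 < z <= 1 ->
  `|correction S y x| <= z ^- D *
    \prod_i (if i \in S then expR (2 * z * (y i)%:R) else (x i == y i)%:R).
Proof.
case/andP=> z0 z1; have z_ge0 : 0 <= z by exact: ltW.
pose order_cost i (a : nat) : R := `|site_kernel R (i \in S) a (y i) (x i)| * z ^+ a.
have order_cost_ge0 i a : 0 <= order_cost i a by rewrite mulr_ge0 // exprn_ge0.
apply: (@le_trans _ _ (z ^- D * \prod_i \sum_(a < r.+1) order_cost i a)); last first.
  rewrite ler_wpM2l ?invr_ge0 ?exprn_ge0 //; apply: ler_prod => i _.
  rewrite sumr_ge0 //= /order_cost /site_kernel; case: (i \in S).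
    exact: sum_newton_kernel_le_expR.
  under eq_bigr do rewrite normrM !normr_nat -mulrA.
  by rewrite (sum_ord_delta (fun a => (y i == x i :> nat)%:R * z ^+ a)) // mulr1 eq_sym.
rewrite bigA_distr_bigA mulr_sumr /=.
apply: le_trans (ler_norm_sum _ _ _) _; rewrite big_mkcond /=.
apply: ler_sum => al _; case: ifP => alD; last first.
  by rewrite mulr_ge0 ?invr_ge0 ?exprn_ge0 // prodr_ge0.
rewrite big_split /= normr_prod mulrCA ler_peMr ?prodr_ge0 //.
rewrite prodrXr mulrC ler_pdivlMr ?exprn_gt0 // mul1r.
exact: ler_wiXn2l.
Qed.

End Correction.

Lemma exists_heavy_subset (R : realDomainType) (I : finType) (tau : nat -> R) (y : I -> R) :
  exists S : {set I}, (forall i, i \in S -> tau #|S| <= y i) /\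
    \sum_(i | i \notin S) y i <= \sum_(#|S|.+1 <= s < #|I|.+1) tau s.
Proof.
suff remove_light k (S : {set I}) : #|S| = k ->
    \sum_(i | i \notin S) y i <= \sum_(k.+1 <= s < #|I|.+1) tau s ->
    exists S : {set I}, (forall i, i \in S -> tau #|S| <= y i) /\
      \sum_(i | i \notin S) y i <= \sum_(#|S|.+1 <= s < #|I|.+1) tau s.
  apply: (remove_light #|I| [set: I]%SET); first by rewrite cardsT.
  by rewrite big_geq // big1 // => i; rewrite inE.
elim: k S => [|k IH] S Sk off_le.
  exists S; split; last by rewrite Sk.
  by move: Sk => /eqP; rewrite cards_eq0 => /eqP -> i; rewrite inE.
case: (pickP (fun i => (i \in S) && (y i < tau #|S|))) => [i /andP[iS yi]|none].
  apply: (IH (S :\ i)); first by apply: succn_inj; rewrite -Sk (cardsD1 i S) iS.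
  rewrite big_ltn; last by rewrite ltnS -Sk max_card.
  rewrite (bigD1 i) /=; last by rewrite !inE eqxx.
  rewrite lerD //; first by rewrite -Sk ltW.
  rewrite (eq_bigl (fun j => j \notin S)) // => j.
  by rewrite !inE; case: (eqVneq j i) => [->|] /=; rewrite ?iS ?andbT.
exists S; split; last by rewrite Sk.
by move=> i iS; have := none i; rewrite iS /= => /negbT; rewrite -leNgt.
Qed.

Section Truncation.
Variables (R : realType) (I : finType) (r D theta : nat) (c z C beta : R).
Local Notation point := {ffun I -> 'I_r.+1}.
Implicit Types (S : {set I}) (x y : point).
Variables (tau : nat -> R) (L : point -> R).

Hypothesis tau_gt0 : forall s, (0 < s)%N -> 0 < tau s.

Definition heavy S y : bool :=
  [&& (0 < #|S|)%N, [forall i, (i \in S) ==> (tau #|S| <= (y i)%:R)],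
      \sum_(i | i \notin S) (y i)%:R <= theta%:R / 2 :> R &
      theta%:R / 2 <= \sum_(i in S) (y i)%:R :> R].

Let heavy_gt0 S y i : heavy S y -> i \in S -> (0 < y i)%N.
Proof.
move=> /and4P[S0 /forallP tau_le _ _] iS; have /implyP/(_ iS) := tau_le i.
by move=> /(lt_le_trans (tau_gt0 S0)); rewrite ltr0n.
Qed.

Lemma heavy_exists y : \sum_(1 <= s < #|I|.+1) tau s <= theta%:R / 2 ->
  (theta < \sum_i y i)%N -> exists S, heavy S y.
Proof.
move=> tau_sum theta_lt.
have [S [S_tau S_off]] := exists_heavy_subset tau (fun i => (y i)%:R).
have off_le : \sum_(i | i \notin S) (y i)%:R <= theta%:R / 2 :> R.
  apply: le_trans S_off (le_trans _ tau_sum).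
  rewrite [X in _ <= X](big_cat_nat (n := #|S|.+1)) //=; last by rewrite ltnS max_card.
  by rewrite lerDr big_nat_cond sumr_ge0 // => s /andP[/andP[s0 _] _]; rewrite ltW ?tau_gt0.
have theta_split : theta%:R < \sum_(i in S) (y i)%:R + \sum_(i | i \notin S) (y i)%:R :> R.
  by rewrite -[X in _ < X](bigID (mem S) predT (fun i => (y i)%:R)) -natr_sum ltr_nat.
have on_gt : theta%:R / 2 < \sum_(i in S) (y i)%:R :> R by lra.
exists S; apply/and4P; split=> //; [|by apply/forallP => i; apply/implyP/S_tau|exact: ltW].
rewrite lt0n cards_eq0; apply: contraTneq on_gt => ->.
by rewrite big_set0 -leNgt divr_ge0.
Qed.

Hypothesis theta_ge : (#|I| + D)%:R <= theta%:R / 2 :> R.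

Lemma correction_weight_le S x y : heavy S y -> correction R D S y x != 0 ->
  (\sum_i x i <= theta)%N.
Proof.
move=> /and4P[_ _ off_le _] /correction_neq0[x_off _ x_on].
rewrite -(ler_nat R) (bigID (mem S)) /= natrD (splitr theta%:R) lerD //.
  by apply: le_trans theta_ge; rewrite ler_nat (leq_trans x_on) // leq_add2r max_card.
by rewrite natr_sum (eq_bigr (fun i => (y i)%:R)) // => i iS; rewrite x_off.
Qed.

Hypotheses (c_gt0 : 0 < c) (z_gt0 : 0 < z) (z_le1 : z <= 1).
Hypotheses (C_ge0 : 0 <= C) (beta_ge1 : 1 <= beta).
Hypothesis L_ge0 : forall y, 0 <= L y.
Hypothesis L_movable : movable (geometric c z) (decay_envelope C beta) L.

Let T : R := C / (c * z).

Let T_ge0 : 0 <= T.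
Proof. by rewrite divr_ge0 // mulr_ge0 // ltW. Qed.

Let beta_gt0 : 0 < beta. Proof. exact: lt_le_trans beta_ge1. Qed.

Let move_cost S x y : heavy S y -> correction R D S y x != 0 ->
  L y <= L x * z ^- D * \prod_(i in S) ((c * z)^-1 * decay_envelope C beta (y i)).
Proof.
move=> S_heavy /correction_neq0[x_off x_pos x_on].
have moved : L y * \prod_(i in S) geometric c z (x i) <=
    L x * \prod_(i in S) decay_envelope C beta (y i).
  by apply: L_movable => // i iS; split; [exact: x_pos|exact: heavy_gt0 iS].
have cz_gt0 : 0 < (c * z) ^+ #|S| * z ^+ D by rewrite mulr_gt0 ?exprn_gt0 // mulr_gt0.
have lo_ge : (c * z) ^+ #|S| * z ^+ D <= \prod_(i in S) geometric c z (x i).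
  rewrite /geometric /= big_split /= prodr_const prodrXr exprMn -mulrA -exprD.
  by rewrite ler_wpM2l ?exprn_ge0 ?(ltW c_gt0) // ler_wiXn2l // ltW.
have := le_trans (ler_wpM2l (L_ge0 y) lo_ge) moved.
have -> : \prod_(i in S) ((c * z)^-1 * decay_envelope C beta (y i)) =
    (c * z)^-1 ^+ #|S| * \prod_(i in S) decay_envelope C beta (y i).
  by rewrite [LHS]big_split prodr_const.
rewrite -ler_pdivlMr // invfM -exprVn => /le_trans; apply.
by rewrite le_eqVlt; apply/orP; left; apply/eqP; ring.
Qed.

Hypothesis theta_exp : (4 * beta / z) ^+ D <= expR (theta%:R / (4 * beta)).

(* The envelope gives exp(-y_i / beta) and the kernel costs exp(y_i / (2 beta)); *)
(* as the coordinates in S carry weight at least theta / 2, the surplus          *)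
(* exp(-theta / (4 beta)) pays for the factors exponential in D.                 *)
Let correction_cost S x y : heavy S y -> correction R D S y x != 0 ->
  L y * `|correction R D S y x| <= L x * \prod_(i in S) (T / (y i)%:R ^+ 2).
Proof.
move=> S_heavy corr_neq0; have [x_off _ _] := correction_neq0 corr_neq0.
have u_le1 : 0 < (4 * beta)^-1 <= 1.
  by rewrite invr_gt0 mulr_gt0 //= invf_le1 ?mulr_gt0 //; move: beta_ge1; lra.
have corr_le := correction_le D S y x u_le1.
rewrite (_ : \prod_i _ = \prod_(i in S) expR (2 * (4 * beta)^-1 * (y i)%:R)) in corr_le;
  last first.
  rewrite [RHS]big_mkcond; apply: eq_bigr => i _; case: ifPn => // iS.
  by rewrite x_off // eqxx.
apply: le_trans (ler_pM (L_ge0 y) (normr_ge0 _) (move_cost S_heavy corr_neq0) corr_le) _.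
rewrite mulrACA -big_split /=.
rewrite (eq_bigr (fun i => T / (y i)%:R ^+ 2 * expR (- ((y i)%:R / (2 * beta))))); last first.
  move=> i iS; rewrite /decay_envelope.
  have -> : - ((y i)%:R / (2 * beta)) =
      - ((y i)%:R / beta) + 2 * (4 * beta)^-1 * (y i)%:R :> R.
    by field; rewrite gt_eqF.
  by rewrite expRD /T; ring.
rewrite big_split /= -expR_sum sumrN -mulr_suml.
have prod_ge0 : 0 <= \prod_(i in S) (T / (y i)%:R ^+ 2).
  by apply: prodr_ge0 => i _; rewrite divr_ge0 // exprn_ge0.
rewrite -[L x * _ * _]mulrA mulrACA ler_piMr ?mulr_ge0 //.
rewrite -[z ^- D]exprVn -[(_^-1) ^- D]exprVn invrK -exprMn.
rewrite (_ : z^-1 * (4 * beta) = 4 * beta / z); last by ring.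
rewrite expRN ler_pdivrMr ?expR_gt0 // mul1r; apply: le_trans theta_exp _.
move: S_heavy => /and4P[_ _ _ on_ge].
rewrite ler_expR (_ : theta%:R / (4 * beta) = theta%:R / 2 / (2 * beta)).
  by rewrite ler_pM2r // invr_gt0 mulr_gt0.
by field; rewrite gt_eqF.
Qed.

Hypothesis tau_sum : \sum_(1 <= s < #|I|.+1) tau s <= theta%:R / 2.
Hypothesis tau_tail : \sum_(S : {set I} | (0 < #|S|)%N) (2 * T / tau #|S|) ^+ #|S| <= 1.

Let sum_correction_cost x :
  \sum_(y : point) \sum_(S : {set I} | heavy S y && (correction R D S y x != 0))
    L y * `|correction R D S y x| <= L x.
Proof.
pose F S i (t : nat) : R :=
  if i \in S then (if tau #|S| <= t%:R then T * t%:R ^- 2 else 0) else (t == x i)%:R.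
have F_ge0 S i t : 0 <= F S i t.
  by rewrite /F; do 2?[case: ifP => // _]; rewrite divr_ge0 // exprn_ge0.
apply: (@le_trans _ _ (L x * \sum_(y : point) \sum_(S : {set I} | (0 < #|S|)%N)
    \prod_i F S i (y i))).
  rewrite mulr_sumr; apply: ler_sum => y _; rewrite mulr_sumr.
  rewrite big_mkcond [X in _ <= X]big_mkcond; apply: ler_sum => S _.
  case: ifP => [/andP[S_heavy corr_neq0]|_]; last first.
    by case: ifP => // _; rewrite mulr_ge0 ?prodr_ge0.
  have [x_off _ _] := correction_neq0 corr_neq0.
  have /and4P[-> /forallP tau_le _ _] := S_heavy.
  apply: le_trans (correction_cost S_heavy corr_neq0) _.
  rewrite ler_wpM2l // [X in X <= _]big_mkcond (eq_bigr (fun i => F S i (y i))) // => i _.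
  rewrite /F; case: ifPn => iS; last by rewrite x_off // eqxx.
  by have /implyP/(_ iS) -> := tau_le i.
rewrite exchange_big ler_piMr //=; apply: le_trans tau_tail.
apply: ler_sum => S S_gt0.
rewrite -(bigA_distr_bigA (fun i (t : 'I_r.+1) => F S i t)).
rewrite (eq_bigr (fun i => if i \in S then \sum_(t < r.+1) F S i t else 1)); last first.
  move=> i _; case: ifPn => // iS; rewrite /F (negbTE iS).
  under eq_bigr do rewrite -[_%:R]mulr1.
  by rewrite (sum_ord_delta (fun=> 1)) // -ltnS.
rewrite -big_mkcond -prodr_const; apply: ler_prod => i iS; rewrite sumr_ge0 //=.
rewrite /F iS -big_mkcond -mulr_sumr -mulrA mulrCA ler_wpM2l //.
by apply: sum_inv_sq_ge; exact: tau_gt0.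
Qed.

Lemma truncation_of_thresholds : exists Lt : point -> R,
  [/\ forall x, 0 <= Lt x, forall x, Lt x != 0 -> L x != 0 /\ (\sum_i x i <= theta)%N &
      same_moments D Lt L].
Proof.
have heavy_choice y : exists S, (theta < \sum_i y i)%N -> heavy S y.
  have [/(heavy_exists tau_sum)[S S_heavy]|_] := ltnP theta (\sum_i y i); first by exists S.
  by exists finset.set0.
have [heavy_set heavy_set_heavy] := choice heavy_choice.
pose err x := \sum_(y : point | (theta < \sum_i y i)%N) correction R D (heavy_set y) y x * L y.
have err_le x : `|err x| <= L x.
  apply: le_trans (sum_correction_cost x); apply: le_trans (ler_norm_sum _ _ _) _.
  rewrite big_mkcond; apply: ler_sum => y _; case: ifP => [theta_lt|_]; last first.
    by rewrite sumr_ge0 // => S _; rewrite mulr_ge0.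
  rewrite normrM mulrC ger0_norm //.
  have [->|corr_neq0] := eqVneq (correction R D (heavy_set y) y x) 0.
    by rewrite normr0 mulr0 sumr_ge0 // => S _; rewrite mulr_ge0.
  rewrite (bigD1 (heavy_set y)) /= ?heavy_set_heavy ?corr_neq0 // lerDl sumr_ge0 // => S _.
  by rewrite mulr_ge0.
have err_eq0 x : (theta < \sum_i x i)%N -> err x = 0.
  move=> x_heavy; rewrite /err big1 // => y y_heavy.
  have [->|corr_neq0] := eqVneq (correction R D (heavy_set y) y x) 0; first by rewrite mul0r.
  by move: x_heavy; rewrite ltnNge (correction_weight_le (heavy_set_heavy y y_heavy) corr_neq0).
exists (fun x => if (\sum_i x i <= theta)%N then L x + err x else 0); split=> [x|x|e eD].
- by case: ifP => // _; have := err_le x; rewrite ler_norml => /andP[]; lra.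
- case: ifP => [x_light nz|_]; last by rewrite eqxx.
  split=> //; apply: contraNneq nz => Lx0.
  by have := err_le x; rewrite Lx0 normr_le0 add0r.
transitivity (moment (fun x => if (\sum_i x i <= theta)%N then L x else 0) e + moment err e).
  rewrite -big_split; apply: eq_bigr => x _ /=; rewrite -mulrDl; congr (_ * _).
  by case: leqP => // x_heavy; rewrite err_eq0 // addr0.
rewrite moment_sum [RHS](bigID (fun x : point => (\sum_i x i <= theta)%N)) /=; congr (_ + _).
  by rewrite [RHS]big_mkcond; apply: eq_bigr => x _; case: ifP; rewrite ?mul0r.
apply: eq_big => [y|y y_heavy]; first by rewrite ltnNge.
rewrite momentMr correction_moment // 1?mulrC // => i.
by apply: heavy_gt0; exact: heavy_set_heavy.
Qed.

End Truncation.

Section Thresholds.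
Variable R : realType.

Lemma expR_le2 (x : R) : x <= 1 / 2 -> expR x <= 2.
Proof.
move=> x2; rewrite -[x]opprK expRN invf_ple ?posrE ?expR_gt0 //.
by apply: le_trans (expR_ge1Dx _); lra.
Qed.

Lemma expR1_le4 : expR 1 <= 4 :> R.
Proof.
have half_le : expR (1 / 2) <= 2 :> R by exact: expR_le2.
rewrite (splitr 1) expRD; apply: le_trans (ler_pM _ _ half_le half_le) _; rewrite ?expR_ge0 //.
lra.
Qed.

Lemma ln2_ge : 1 / 2 <= ln 2 :> R.
Proof. by rewrite -ler_expR lnK ?posrE // expR_le2. Qed.

Lemma harmonic_series_le (N : nat) : (0 < N)%N -> series harmonic N <= 1 + ln N%:R :> R.
Proof.
case: N => // N _; elim: N => [|N IH].
  by rewrite /series /= big_nat1 invr1 ln1 addr0.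
rewrite seriesSr; apply: le_trans (lerD IH (lexx _)) _.
rewrite -addrA lerD2l -lerBrDl.
have N1_gt0 : 0 < N.+1%:R :> R by []. have N2_gt0 : 0 < N.+2%:R :> R by [].
rewrite -ln_div ?posrE // -lerN2 -lnV ?posrE ?divr_gt0 // invf_div /harmonic /=.
have -> : N.+1%:R / N.+2%:R = 1 + (- N.+2%:R^-1) :> R.
  by rewrite -[N.+2]addn1 natrD; field; rewrite gt_eqF // -natrD addn1.
by apply: le_ln1Dx; rewrite ltrN2 invf_lt1 // ltr1n.
Qed.

Lemma bin_exp_le (N s : nat) : (0 < N)%N ->
  'C(N, s)%:R * s%:R ^+ s <= (expR 1 * N%:R) ^+ s :> R.
Proof.
move=> N0; have NR : 0 < N%:R :> R by rewrite ltr0n.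
have [sN|Ns] := leqP s N; last first.
  by rewrite bin_small // mul0r exprn_ge0 // mulr_ge0 // expR_ge0.
have bin_le : 'C(N, s)%:R * (s%:R / N%:R) ^+ s <= expR (s%:R) :> R.
  apply: (@le_trans _ _ ((1 + s%:R / N%:R) ^+ N)).
    rewrite exprDn (bigD1 (inord s)) //= inordK ?ltnS // expr1n mul1r.
    rewrite -[_ ^+ s *+ _]mulr_natl lerDl; apply: sumr_ge0 => i _.
    by apply: mulrn_wge0; rewrite expr1n mul1r exprn_ge0 // divr_ge0.
  rewrite -[X in expR X](divfK (lt0r_neq0 NR)) expRM_natr.
  by apply: lerXn2r; rewrite ?nnegrE ?expR_ge0 ?addr_ge0 ?divr_ge0 // expR_ge1Dx.
rewrite exprMn -expRM_natr mul1r -ler_pdivrMr ?exprn_gt0 //.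
by rewrite -mulrA -exprVn -exprMn.
Qed.

Lemma sum_by_card (V : nmodType) (I : finType) (f : nat -> V) :
  \sum_(S : {set I} | (0 < #|S|)%N) f #|S| = \sum_(s < #|I|) f s.+1 *+ 'C(#|I|, s.+1).
Proof.
pose card_ord (S : {set I}) : 'I_#|I|.+1 := inord #|S|.
have card_ordE S : card_ord S = #|S| :> nat by rewrite inordK // ltnS max_card.
rewrite (partition_big card_ord (fun s : 'I_#|I|.+1 => (0 < s)%N)) /=; last first.
  by move=> S; rewrite card_ordE.
rewrite big_mkcond big_ord_recl /= add0r; apply: eq_bigr => s _.
rewrite -card_draws -sumr_const; apply: eq_big => [S|S /andP[_ /eqP Ss]].
  rewrite inE -(inj_eq val_inj) /= card_ordE.
  by case: eqP => [->|]; rewrite ?andbF.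
by rewrite -card_ordE Ss.
Qed.

Lemma sum_set_pow_le1 (I : finType) (w : R) : (0 < #|I|)%N -> 0 <= w ->
  w * (expR 1 * #|I|%:R) <= 1 / 2 ->
  \sum_(S : {set I} | (0 < #|S|)%N) (w * #|S|%:R) ^+ #|S| <= 1.
Proof.
move=> I_gt0 w_ge0 w_le; rewrite (sum_by_card I (fun s => (w * s%:R) ^+ s)).
apply: (@le_trans _ _ (\sum_(s < #|I|) geometric (1 / 2) (1 / 2) s)).
  apply: ler_sum => s _; rewrite /= -exprS exprMn -[_ *+ 'C(_, _)]mulr_natl mulrCA.
  apply: le_trans (ler_wpM2l (exprn_ge0 _ w_ge0) (bin_exp_le _ I_gt0)) _.
  by rewrite -exprMn; apply: lerXn2r; rewrite ?nnegrE // !mulr_ge0 // expR_ge0.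
rewrite -(big_mkord predT (geometric (1 / 2) (1 / 2))).
apply: le_trans (geometric_le_lim _ _ _ _) _; rewrite ?ger0_norm; try lra.
by rewrite (_ : 1 - 1 / 2 = 1 / 2) ?divff; lra.
Qed.

End Thresholds.

(* The three lower bounds on theta pay for summing over the possible sets of    *)
(* large coordinates, for moving these coordinates, and for their final weight. *)
Definition ample_weight (R : realType) (c z C beta : R) (N D theta : nat) : Prop :=
  [/\ 8 * expR 1 * (C / (c * z)) * N%:R * (1 + ln N%:R) <= theta%:R,
      4 * beta * D%:R * ln (4 * beta / z) <= theta%:R &
      2 * (N + D)%:R <= theta%:R :> R].

(* The thresholds tau s = theta / (2 H s), with H the harmonic sum, spread half  *)
(* of theta over the possible sizes s of the set of large coordinates.           *)
Theorem truncation (R : realType) (I : finType) (r D theta : nat) (c z C beta : R)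
    (L : {ffun I -> 'I_r.+1} -> R) :
  (0 < #|I|)%N -> 0 < c -> 0 < z -> z <= 1 -> 0 <= C -> 1 <= beta ->
  ample_weight c z C beta #|I| D theta ->
  (forall y, 0 <= L y) -> movable (geometric c z) (decay_envelope C beta) L ->
  exists Lt : {ffun I -> 'I_r.+1} -> R,
  [/\ forall x, 0 <= Lt x, forall x, Lt x != 0 -> L x != 0 /\ (\sum_i x i <= theta)%N &
      same_moments D Lt L].
Proof.
move=> I_gt0 c_gt0 z_gt0 z_le1 C_ge0 beta_ge1 [theta_T theta_D theta_N] L_ge0 L_mov.
set T := C / (c * z) in theta_T.
have T_ge0 : 0 <= T by rewrite divr_ge0 // mulr_ge0 // ltW.
have beta_gt0 : 0 < beta by exact: lt_le_trans beta_ge1.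
have theta_gt0 : 0 < theta%:R :> R.
  by apply: lt_le_trans theta_N; rewrite mulr_gt0 // ltr0n addn_gt0 I_gt0.
pose H : R := series harmonic #|I|.
have H_gt0 : 0 < H.
  rewrite /H /series /= big_ltn // ltr_pwDl ?harmonic_gt0 //.
  by rewrite sumr_ge0 // => s _; exact: harmonic_ge0.
pose tau s : R := theta%:R / (2 * H) / s%:R.
have tau_gt0 s : (0 < s)%N -> 0 < tau s.
  by move=> s0; rewrite divr_gt0 ?ltr0n // divr_gt0 // mulr_gt0.
have tau_sum : \sum_(1 <= s < #|I|.+1) tau s <= theta%:R / 2.
  rewrite -mulr_sumr big_add1 /= -[\sum_(0 <= i < _) _]/H.
  rewrite (_ : _ * H = theta%:R / 2) //.
  by field; rewrite gt_eqF.
have tau_tail : \sum_(S : {set I} | (0 < #|S|)%N) (2 * T / tau #|S|) ^+ #|S| <= 1.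
  rewrite (eq_bigr (fun S : {set I} => (4 * T * H / theta%:R * #|S|%:R) ^+ #|S|)).
    apply: sum_set_pow_le1 => //.
      by rewrite divr_ge0 // mulr_ge0 ?(ltW H_gt0) // mulr_ge0.
    rewrite mulrAC ler_pdivrMr // mulrC.
    have H_le : H <= 1 + ln #|I|%:R by exact: harmonic_series_le.
    suff : 8 * expR 1 * T * #|I|%:R * H <= theta%:R by lra.
    apply: le_trans theta_T; apply: ler_wpM2l H_le.
    by rewrite mulr_ge0 // mulr_ge0 // mulr_ge0 // expR_ge0.
  move=> S S0; congr (_ ^+ _); rewrite /tau.
  by field; rewrite !gt_eqF // ltr0n.
have theta_exp : (4 * beta / z) ^+ D <= expR (theta%:R / (4 * beta)).
  have base_gt0 : 0 < 4 * beta / z by rewrite divr_gt0 // mulr_gt0.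
  rewrite -[X in X ^+ _]lnK ?posrE // -expRM_natr ler_expR ler_pdivlMr ?mulr_gt0 //.
  by rewrite mulrC [ln _ * _]mulrC mulrA.
apply: (truncation_of_thresholds tau_gt0 _ c_gt0 z_gt0 z_le1 C_ge0 beta_ge1 L_ge0 L_mov
  theta_exp tau_sum tau_tail).
by rewrite ler_pdivlMr // mulrC.
Qed.

(** * Pulling an approximant back to the cube *)

Lemma convex_set_barycenter (R : realFieldType) (M : lmodType R)
    (A : set (convex_lmodType M)) (J : Type) (s : seq J) (w : J -> R) (v : J -> M) :
  convex_set A -> (forall j, 0 <= w j) -> (forall j, w j != 0 -> A (v j)) ->
  0 < \sum_(j <- s) w j -> A ((\sum_(j <- s) w j)^-1 *: \sum_(j <- s) w j *: v j).
Proof.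
move=> convA w_ge0 wA.
pose average (W : R) (V : M) := (W = 0 /\ V = 0) \/ (0 < W /\ A (W^-1 *: V)).
suff [[-> _]|[_ AV] _ //] : average (\sum_(j <- s) w j) (\sum_(j <- s) w j *: v j).
  by rewrite ltxx.
apply: (big_ind2 average); first by left.
  move=> W V W' V' [[-> ->]|[W_gt0 AV]] [[-> ->]|[W'_gt0 AV']]; rewrite ?add0r ?addr0;
    [by left|by right|by right|right].
  have sum_gt0 : 0 < W + W' by rewrite addr_gt0.
  split=> //.
  have l_ge0 : 0 <= W / (W + W') by rewrite divr_ge0 // ltW.
  have l_le1 : W / (W + W') <= 1 by rewrite ler_pdivrMr // mul1r lerDl ltW.
  have := convA (W^-1 *: V) (W'^-1 *: V') (Itv01 l_ge0 l_le1); rewrite !inE => /(_ AV AV').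
  congr (A _); rewrite /conv /= /unstable.onem scalerDr !scalerA.
  by congr (_ *: _ + _ *: _); field; rewrite !gt_eqF.
move=> j _; have [->|wj] := eqVneq (w j) 0; first by rewrite scale0r; left.
by right; rewrite lt0r wj w_ge0 scalerA mulVf // scale1r; split=> //; exact: wA.
Qed.

Section Blocks.
Variables (R : realType) (K J : finType) (r : nat).
Local Notation block_point := {ffun J -> 'I_r.+1}.
Local Notation point := {ffun K * J -> 'I_r.+1}.
Implicit Types (G : K -> block_point -> R) (y : point).

Definition block y (i : K) : block_point := [ffun j => y (i, j)].

Definition block_product G y : R := \prod_i G i (block y i).

Lemma sum_block_product G : \sum_y block_product G y = \prod_i \sum_b G i b.
Proof.
rewrite bigA_distr_bigA.
pose uncurry (h : {ffun K -> block_point}) : point := [ffun p => h p.1 p.2].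
rewrite (reindex uncurry) /=; last first.
  apply: onW_bij; exists (fun y : point => [ffun i => block y i]) => [h|y].
    by apply/ffunP => i; apply/ffunP => j; rewrite !ffunE.
  by apply/ffunP => -[i j]; rewrite !ffunE.
apply: eq_bigr => h _; apply: eq_bigr => i _; congr (G i _).
by apply/ffunP => j; rewrite !ffunE.
Qed.

Lemma moment_block_product G (e : K * J -> nat) :
  moment (block_product G) e = \prod_i moment (G i) (fun j => e (i, j)).
Proof.
rewrite -sum_block_product; apply: eq_bigr => y _; rewrite [RHS]big_split; congr (_ * _).
rewrite /monomial (pair_bigA _ (fun i j => (block y i j)%:R ^+ e (i, j))) /=.
by apply: eq_bigr => -[i j] _; rewrite ffunE.
Qed.

(* A monomial of degree D < |U| (d + 1) has degree at most d in some block of U. *)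
Lemma moment_block_product_eq0 G (U : {set K}) (d D : nat) (e : K * J -> nat) :
  (forall i, i \in U -> same_moments d (G i) (fun=> 0)) ->
  (\sum_p e p <= D)%N -> (D < #|U| * d.+1)%N -> moment (block_product G) e = 0.
Proof.
move=> G_eq0 eD DU; rewrite moment_block_product.
have [|i /= iU ei] :=
  @ltn_sum_exists K (fun i => i \in U) (fun i => \sum_j e (i, j))%N (fun=> d.+1).
  rewrite sum_nat_const (leq_ltn_trans _ DU) // (leq_trans _ eD) //.
  rewrite [leqRHS](eq_bigr (fun p => e (p.1, p.2))); last by case.
  by rewrite -(pair_bigA _ (fun i j => e (i, j))) [leqRHS](bigID (mem U)) leq_addr.
rewrite (bigD1 i) //= (G_eq0 i iU) // [X in X * _]big1 ?mul0r // => b _.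
by rewrite mul0r.
Qed.

Lemma movable_block_product (lo hi : nat -> R) G :
  (forall t, (0 < t)%N -> 0 <= lo t) -> (forall i b, 0 <= G i b) ->
  (forall i, movable lo hi (G i)) -> movable lo hi (block_product G).
Proof.
move=> lo_ge0 G_ge0 G_mov S x y xy pos.
pose Sb i := [set j | (i, j) \in S]%SET.
have split_blocks (h : nat -> R) (u : point) :
    \prod_(p in S) h (u p) = \prod_i \prod_(j in Sb i) h (block u i j).
  rewrite big_mkcond /=; under [RHS]eq_bigr do rewrite big_mkcond /=.
  rewrite (pair_bigA _ (fun i j => if j \in Sb i then h (block u i j) else 1)) /=.
  by apply: eq_bigr => -[i j] _; rewrite inE ffunE.
rewrite !split_blocks -!big_split /=; apply: ler_prod => i _; apply/andP; split.
  by rewrite mulr_ge0 // prodr_ge0 // => j; rewrite inE => /pos[x0 _]; rewrite ffunE lo_ge0.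
by apply: G_mov => j; rewrite inE !ffunE; [exact: xy|exact: pos].
Qed.

End Blocks.

Section Evaluation.
Variables (R : realType) (n m r : nat).
Local Notation point := {ffun 'I_n * 'I_m -> 'I_r.+1}.
Implicit Types (y : point) (L : point -> R) (p : mpoly (n * m) R).

Definition word_of y : 'rV['I_r.+1]_(n * m) := mxvec (\matrix_(i, j) y (i, j)).

Definition eval_word p y : R := meval (map_mx (@ord_val R r.+1) (word_of y) 0) p.

Definition exponents (mon : multinom (n * m)) (k : 'I_n * 'I_m) : nat :=
  fun_of_multinom mon (mxvec_index k.1 k.2).

Lemma eval_wordE p y : eval_word p y =
  \sum_(mon <- msupp p) mcoeff mon p * monomial R (exponents mon) y.
Proof.
rewrite /eval_word mevalE; apply: eq_bigr => mon _; congr (_ * _).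
rewrite (reindex _ (curry_mxvec_bij _ _)) /=.
by apply: eq_bigr => -[i j] _; rewrite /exponents /= !mxE mxvecE mxE.
Qed.

Lemma sum_exponents_le p (mon : multinom (n * m)) :
  mon \in msupp p -> (\sum_k exponents mon k <= totdeg p)%N.
Proof.
move=> /msize_mdeg_lt; rewrite mdegE (reindex _ (curry_mxvec_bij _ _)) /= /totdeg => mon_lt.
rewrite -ltnS (ltn_predK mon_lt) (leq_ltn_trans _ mon_lt) //.
by apply/eq_leq/eq_bigr => -[i j] _.
Qed.

Lemma expect_same_moments p L L' : same_moments (totdeg p) L L' ->
  \sum_y L y * eval_word p y = \sum_y L' y * eval_word p y.
Proof.
move=> LL'; have expect (M : point -> R) : \sum_y M y * eval_word p y =
    \sum_(mon <- msupp p) mcoeff mon p * moment M (exponents mon).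
  under eq_bigr do rewrite eval_wordE mulr_sumr.
  rewrite exchange_big /=; apply: eq_bigr => mon _; rewrite mulr_sumr.
  by apply: eq_bigr => y _; rewrite mulrCA.
rewrite !expect big_seq [RHS]big_seq; apply: eq_bigr => mon mon_p.
by rewrite LL' // sum_exponents_le.
Qed.

Lemma word_of_weight y (theta : nat) :
  (word_of y \in weight_le r.+1 (n * m) theta) = (\sum_k y k <= theta)%N.
Proof.
rewrite inE (reindex _ (curry_mxvec_bij _ _)) /=; congr (_ <= _)%N.
by apply: eq_bigr => -[i j] _; rewrite mxvecE mxE.
Qed.

End Evaluation.

Section AveragePolynomial.
Variables (R : realType) (n m r d : nat) (L : bool -> {ffun 'I_m -> 'I_r.+1} -> R).
Variable p : mpoly (n * m) R.
Local Notation point := {ffun 'I_n * 'I_m -> 'I_r.+1}.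
Implicit Types (U : {set 'I_n}) (z : 'rV[bool]_n) (y : point).

Definition increment U i (b : {ffun 'I_m -> 'I_r.+1}) : R :=
  if i \in U then L true b - L false b else L false b.

Definition increment_coef U : R := \sum_y block_product (increment U) y * eval_word p y.

Definition set_multinom U : multinom n := Multinom [tuple (i \in U : nat) | i < n].

Definition average_poly : mpoly n R :=
  \sum_(U : {set 'I_n} | (#|U| * d.+1 <= totdeg p)%N)
    increment_coef U *: mpolyX R (set_multinom U).

Let set_multinomE U i : fun_of_multinom (set_multinom U) i = (i \in U) :> nat.
Proof. by rewrite mnmE. Qed.

Lemma totdeg_average_poly : (totdeg average_poly * d.+1 <= totdeg p)%N.
Proof.
rewrite -leq_divRL // {1}/totdeg.
suff : (msize average_poly <= (totdeg p %/ d.+1).+1)%N by case: (msize average_poly).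
apply: leq_trans (msize_sum _ _ _) _; apply/bigmax_leqP => U UD.
apply: leq_trans (msizeZ_le _ _) _; rewrite msizeX ltnS leq_divRL //.
rewrite (_ : mdeg _ = #|U|) // mdegE -sum1_card [RHS]big_mkcond /=.
by apply: eq_bigr => i _; rewrite set_multinomE; case: (i \in U).
Qed.

Lemma block_product_increments z y : block_product (fun i => L (z 0 i)) y =
  \sum_(U : {set 'I_n}) block_product (increment U) y * \prod_i (z 0 i)%:R ^+ (i \in U).
Proof.
transitivity (\prod_i ((z 0 i)%:R * (L true (block y i) - L false (block y i)) +
    L false (block y i))).
  by apply: eq_bigr => i _; case: (z 0 i); rewrite ?mul1r ?mul0r ?add0r ?subrK.
rewrite (@bigA_distr R 0 1); apply: eq_bigr => U _; rewrite -big_split /=.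
apply: eq_bigr => i _; rewrite /increment; case: (i \in U); last by rewrite mulr1.
by rewrite mulrC.
Qed.

Hypothesis L_same : same_moments d (L true) (L false).

Let increment_coef_eq0 U : (totdeg p < #|U| * d.+1)%N -> increment_coef U = 0.
Proof.
move=> DU; rewrite /increment_coef (expect_same_moments (L' := fun=> 0)).
  by rewrite big1 // => y _; rewrite mul0r.
move=> e eD; rewrite (moment_block_product_eq0 _ eD DU).
  by rewrite /moment big1 // => y _; rewrite mul0r.
move=> i iU c cd; rewrite /increment iU momentB L_same // subrr.
by rewrite /moment big1 // => y _; rewrite mul0r.
Qed.

Lemma meval_average_poly z : meval (map_mx (@bool_val R) z 0) average_poly =
  \sum_y block_product (fun i => L (z 0 i)) y * eval_word p y.
Proof.
under [RHS]eq_bigr do rewrite block_product_increments mulr_suml.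
rewrite exchange_big raddf_sum /=.
rewrite [RHS](bigID (fun U : {set 'I_n} => (#|U| * d.+1 <= totdeg p)%N)) /=.
have coefE U : \sum_y block_product (increment U) y * \prod_i (z 0 i)%:R ^+ (i \in U) *
    eval_word p y = increment_coef U * \prod_i (z 0 i)%:R ^+ (i \in U).
  by rewrite mulr_suml; apply: eq_bigr => y _; rewrite mulrAC.
rewrite [X in _ = _ + X]big1 ?addr0 => [|U]; last first.
  by rewrite -ltnNge coefE => /increment_coef_eq0 ->; rewrite mul0r.
apply: eq_bigr => U _; rewrite mevalZ mevalX coefE; congr (_ * _).
by apply: eq_bigr => i _; rewrite set_multinomE mxE.
Qed.

End AveragePolynomial.

Lemma target_convex (R : realType) (I0 I1 Is : set R^o) (o : option bool) :
  convex_set I0 -> convex_set I1 -> convex_set Is ->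
  convex_set (target I0 I1 Is o : set R^o).
Proof. by case: o => [[]|]. Qed.

Section Transfer.
Variables (R : realType) (n m r d theta : nat) (I0 I1 Is : set R^o) (c z C beta : R).
Variables (f : 'rV[bool]_n -> option bool) (g : 'rV['I_r.+1]_m -> bool).
Variable L : bool -> {ffun 'I_m -> 'I_r.+1} -> R.
Hypotheses (n_gt0 : (0 < n)%N) (m_gt0 : (0 < m)%N).
Hypotheses (I0_convex : convex_set I0) (I1_convex : convex_set I1) (Is_convex : convex_set Is).
Hypotheses (c_gt0 : 0 < c) (z_gt0 : 0 < z) (z_le1 : z <= 1).
Hypotheses (C_ge0 : 0 <= C) (beta_ge1 : 1 <= beta).
Hypothesis L_dual : dual_pair d (geometric c z) (decay_envelope C beta)
  (fun y => g (\row_j y j)) L.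

Lemma approximant_average_poly (p : mpoly (n * m) R) :
  ample_weight c z C beta (n * m) (totdeg p) theta ->
  approximant I0 I1 Is (@ord_val R r.+1) (weight_le r.+1 (n * m) theta) (block_comp f g) p ->
  approximant I0 I1 Is (@bool_val R) [set: 'rV[bool]_n]%SET f (average_poly d L p).
Proof.
have [L_ge0 L_mass L_supp L_mov L_same] := L_dual.
move=> ample p_approx x _; rewrite meval_average_poly //.
pose Lx := block_product (K := 'I_n) (fun i => L (x 0 i)).
have Lx_mov : movable (geometric c z) (decay_envelope C beta) Lx.
  apply: movable_block_product => // t _; apply: geometric_ge0; exact: ltW.
have Lx_ge0 y : 0 <= Lx y by apply: prodr_ge0.
have card_sites : #|{: 'I_n * 'I_m}| = (n * m)%N by rewrite card_prod !card_ord.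
have sites_gt0 : (0 < #|{: 'I_n * 'I_m}|)%N by rewrite card_sites muln_gt0 n_gt0.
have {}ample : ample_weight c z C beta #|{: 'I_n * 'I_m}| (totdeg p) theta.
  by rewrite card_sites.
have [Lt [Lt_ge0 Lt_supp Lt_same]] :=
  truncation sites_gt0 c_gt0 z_gt0 z_le1 C_ge0 beta_ge1 ample Lx_ge0 Lx_mov.
rewrite -(expect_same_moments Lt_same).
have Lt_mass : \sum_y Lt y = 1.
  by rewrite (same_moments_mass Lt_same) sum_block_product big1.
have word_target y : Lt y != 0 -> target I0 I1 Is (f x) (eval_word p y).
  move=> /Lt_supp[Lx_neq0 y_light].
  suff -> : f x = block_comp f g (word_of y) by apply: p_approx; rewrite word_of_weight.
  congr f; apply/rowP => i; rewrite mxE; apply/esym.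
  have L_neq0 : L (x 0 i) (block y i) != 0.
    by apply: contraNneq Lx_neq0 => L0; rewrite /Lx /block_product (bigD1 i) //= L0 mul0r.
  rewrite -(L_supp _ _ L_neq0); congr g; apply/rowP => j.
  by rewrite /word_of mxvecK !mxE ffunE.
have := convex_set_barycenter (target_convex I0_convex I1_convex Is_convex) Lt_ge0 word_target.
by move=> /(_ (index_enum _)); rewrite Lt_mass invr1 scale1r; apply.
Qed.

Lemma approx_deg_block_comp : I0 !=set0 -> I1 !=set0 -> Is !=set0 ->
  ample_weight c z C beta (n * m) (deg_le I0 I1 Is theta (block_comp f g)) theta ->
  (deg_cube I0 I1 Is f * d.+1 <= deg_le I0 I1 Is theta (block_comp f g))%N.
Proof.
move=> I0n I1n Isn; rewrite /deg_le.
have [[p p_approx <-] _] := approx_degP (weight_le r.+1 (n * m) theta)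
  (block_comp f g) (@ord_val_inj R r.+1) I0n I1n Isn.
have [_ deg_min] := approx_degP [set: 'rV[bool]_n]%SET f (@bool_val_inj R) I0n I1n Isn.
move=> ample; apply: leq_trans (totdeg_average_poly d L p).
by rewrite leq_mul2r deg_min ?orbT //; exact: approximant_average_poly.
Qed.

End Transfer.

(** * The degree lower bound *)

Lemma MPstar_dual_pair (R : realType) (m : nat) : (0 < m)%N ->
  exists L : bool -> {ffun 'I_m -> 'I_(m ^ 2).+1} -> R,
  dual_pair (m %/ 128) (geometric (1 / 64) (1 / 4)) (decay_envelope (9 * 2 ^+ 12) (384 * m)%:R)
    (fun y => MPstar (\row_j y j)) L.
Proof.
move=> m_gt0; have r_gt0 : (0 < m ^ 2)%N by rewrite expn_gt0 m_gt0.
have [w w_light] := light_weight_exists R m_gt0.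
have [|A [B AB]] := base_pair_of_light_weight r_gt0 w_light.
  move=> t t0; apply: geometric_le_decay t0; first by rewrite -natrX (ler_nat _ 1).
  by rewrite (ler_nat _ 2); lia.
have lo_ge0 (t : nat) : (0 < t)%N -> 0 <= geometric (1 / 64) (1 / 4) t :> R.
  by move=> _; apply: geometric_ge0; lra.
have I_gt0 : (0 < #|'I_m|)%N by rewrite card_ord.
have d_le : (2 * (m %/ 128) <= #|'I_m|)%N by rewrite card_ord; lia.
eexists; have := block_dual_pair AB r_gt0 I_gt0 d_le lo_ge0.
have -> : (fun t => 3 * (3 * decay_envelope (2 ^+ 12) (384 * m)%:R t)) =
    decay_envelope (9 * 2 ^+ 12) (384 * m)%:R :> (nat -> R).
  by apply/funext => t; rewrite !decay_envelopeZ mulrA (_ : 3 * 3 = 9) //; lra.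
congr (dual_pair _ _ _ _ _); apply/funext => y.
by apply: eq_forallb => i; rewrite mxE.
Qed.

Lemma ln_le_log2 (R : realType) (x : R) : 1 <= x -> ln x <= log2 x.
Proof.
move=> x1; have ln2_le1 : ln 2 <= 1 :> R.
  by rewrite (_ : 2 = 1 + 1) // le_ln1Dx // (lt_trans _ ltr01) // oppr_lt0.
rewrite /log2 ler_pdivlMr; last by have := ln2_ge R; lra.
by rewrite ler_piMr ?ln_ge0.
Qed.

Section WeightBudget.
Variables (R : realType) (n m : nat).
Hypotheses (n_gt0 : (0 < n)%N) (m_gt0 : (0 < m)%N).
Let l : R := ln (n + m)%:R.

Let l_ge k : (0 < k <= n + m)%N -> ln k%:R <= l.
Proof. by case/andP=> k0 k_le; rewrite ler_ln ?posrE ?ltr0n ?ler_nat ?addn_gt0 ?n_gt0. Qed.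

Let ln2_le : ln 2 <= l. Proof. by apply: (@l_ge 2); rewrite (leq_add n_gt0 m_gt0). Qed.

Let ln_n_le : ln n%:R <= l. Proof. by rewrite l_ge // n_gt0 leq_addr. Qed.

Let ln_m_le : ln m%:R <= l. Proof. by rewrite l_ge // m_gt0 leq_addl. Qed.

Let l_ge_half : 1 / 2 <= l. Proof. exact: le_trans (ln2_ge R) ln2_le. Qed.

Variables D theta : nat.
Hypothesis budget : (D + n)%:R * m%:R * l <= theta%:R / 2 ^+ 31.

Let budget_scaled (k : R) : 0 <= k -> k <= 2 ^+ 31 -> k * ((D + n)%:R * m%:R * l) <= theta%:R.
Proof.
move=> k0 k_le; apply: le_trans (ler_wpM2l k0 budget) _.
by rewrite mulrA ler_pdivrMr ?exprn_gt0 // mulrC ler_wpM2l.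
Qed.

Let l_ge0 : 0 <= l. Proof. by apply: le_trans l_ge_half; lra. Qed.

Let nm_le : n%:R * m%:R * l <= (D + n)%:R * m%:R * l.
Proof. by rewrite !ler_wpM2r // ler_nat leq_addl. Qed.

Let Dm_le : D%:R * m%:R * l <= (D + n)%:R * m%:R * l.
Proof. by rewrite !ler_wpM2r // ler_nat leq_addr. Qed.

Let ample_tail : 8 * expR 1 * (9 * 2 ^+ 12 / (1 / 64 * (1 / 4))) * (n * m)%:R *
  (1 + ln (n * m)%:R) <= theta%:R :> R.
Proof.
have ln_nm_le : 1 + ln (n * m)%:R <= 4 * l.
  rewrite natrM lnM ?posrE ?ltr0n //.
  by move: ln_n_le ln_m_le l_ge_half; lra.
have -> : 9 * 2 ^+ 12 / (1 / 64 * (1 / 4)) = 9 * 2 ^+ 20 :> R by field.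
have scale_ge0 : 0 <= 9 * 2 ^+ 27 :> R by rewrite mulr_ge0 ?exprn_ge0.
have scale_le : 9 * 2 ^+ 27 <= 2 ^+ 31 :> R.
  have -> : 2 ^+ 31 = 2 ^+ 4 * 2 ^+ 27 :> R by rewrite -exprD.
  by rewrite ler_wpM2r ?exprn_ge0 // -natrX ler_nat.
apply: le_trans (budget_scaled scale_ge0 scale_le).
apply: le_trans (ler_wpM2l scale_ge0 nm_le).
have -> : 9 * 2 ^+ 27 * (n%:R * m%:R * l) =
    8 * 4 * (9 * 2 ^+ 20) * (n * m)%:R * (4 * l) :> R by rewrite natrM; ring.
have c_ge0 : 0 <= 9 * 2 ^+ 20 :> R by rewrite mulr_ge0 ?exprn_ge0.
have e_ge0 := expR_ge0 (1 : R).
apply: ler_pM ln_nm_le.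
- by rewrite !mulr_ge0 ?e_ge0 ?c_ge0.
- by rewrite addr_ge0 // ln_ge0 // ler1n muln_gt0 n_gt0.
- apply: ler_wpM2r => //; apply: ler_wpM2r => //; apply: ler_wpM2l => //; exact: expR1_le4.
Qed.

Let ample_moving : 4 * (384 * m)%:R * D%:R * ln (4 * (384 * m)%:R / (1 / 4)) <= theta%:R :> R.
Proof.
have coef_ge0 : 0 <= 4 * (384 * m)%:R * D%:R :> R.
  exact: (mulr_ge0 (mulr_ge0 (ler0n _ 4) (ler0n _ _)) (ler0n _ _)).
have mR_gt0 : 0 < m%:R :> R by rewrite ltr0n.
have pow_gt0 k : 0 < 2 ^+ k :> R by rewrite exprn_gt0.
have arg_le : 4 * (384 * m)%:R / (1 / 4) <= 2 ^+ 13 * m%:R :> R.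
  rewrite (_ : _ / _ = 2 ^+ 11 * 3 * m%:R); last by rewrite natrM; field.
  rewrite ler_wpM2r // (exprD _ 11 2) ler_wpM2l ?(ltW (pow_gt0 _)) //.
  by rewrite -natrX ler_nat.
have ln_le : ln (4 * (384 * m)%:R / (1 / 4)) <= 14 * l.
  apply: (@le_trans _ _ (ln (2 ^+ 13 * m%:R))).
    by rewrite ler_ln ?posrE ?mulr_gt0 ?ltr0n ?muln_gt0 ?m_gt0.
  rewrite lnM ?posrE // lnXn //.
  by move: ln2_le ln_m_le; lra.
have scale_ge0 : 0 <= 3 * 7 * 2 ^+ 10 :> R by rewrite mulr_ge0 ?exprn_ge0 //; lra.
have scale_le : 3 * 7 * 2 ^+ 10 <= 2 ^+ 31 :> R.
  have -> : 2 ^+ 31 = 2 ^+ 5 * 2 ^+ 26 :> R by rewrite -exprD.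
  rewrite ler_pM ?exprn_ge0 ?ler_weXn2l ?ler1n // -?natrM -?natrX ?ler_nat //.
apply: le_trans (budget_scaled scale_ge0 scale_le).
apply: le_trans (ler_wpM2l scale_ge0 Dm_le).
rewrite [X in _ <= X](_ : _ = 4 * (384 * m)%:R * D%:R * (14 * l)); last first.
  by rewrite natrM; ring.
exact: (ler_wpM2l coef_ge0 ln_le).
Qed.

Let ample_room : 2 * (n * m + D)%:R <= theta%:R :> R.
Proof.
have scale_le : 4 <= 2 ^+ 31 :> R.
  rewrite (_ : 4 = 2 ^+ 2); last by ring.
  by rewrite ler_weXn2l // ler1n.
apply: le_trans (budget_scaled _ scale_le) => //.
have count_le : (n * m + D)%:R <= (D + n)%:R * m%:R :> R.
  by rewrite -natrM ler_nat mulnDl addnC leq_add2r leq_pmulr.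
have half_le := ler_wpM2l (mulr_ge0 (ler0n R (D + n)) (ler0n R m)) l_ge_half.
by move: count_le half_le; lra.
Qed.

Lemma ample_weight_of_budget :
  ample_weight (1 / 64 : R) (1 / 4) (9 * 2 ^+ 12) (384 * m)%:R (n * m) D theta.
Proof. exact: And3 ample_tail ample_moving ample_room. Qed.

End WeightBudget.

Lemma deg_block_comp_ge (R : realType) (n m theta : nat) (f : 'rV[bool]_n -> option bool)
    (g : 'rV['I_(m ^ 2).+1]_m -> bool) (I0 I1 Is : set R^o)
    (L : bool -> {ffun 'I_m -> 'I_(m ^ 2).+1} -> R) :
  (0 < n)%N -> (0 < m)%N -> I0 !=set0 -> I1 !=set0 -> Is !=set0 ->
  convex_set I0 -> convex_set I1 -> convex_set Is ->
  dual_pair (m %/ 128) (geometric (1 / 64) (1 / 4) : nat -> R)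
    (decay_envelope (9 * 2 ^+ 12) (384 * m)%:R)
    (fun y => g (\row_j y j)) L ->
  Num.min (2 ^- 31 * m%:R * (deg_cube I0 I1 Is f)%:R)
          (2 ^- 31 * theta%:R / (m%:R * log2 (n + m)%:R) - n%:R) <=
    (deg_le I0 I1 Is theta (block_comp f g))%:R :> R.
Proof.
move=> n0 m0 I0n I1n Isn I0c I1c Isc L_dual.
set deg_f := deg_cube _ _ _ _; set deg_comp := deg_le _ _ _ _ _; rewrite ge_min.
case: (leP (2 ^- 31 * _ / _ - _)) => [_|deg_comp_lt]; first by rewrite orbT.
rewrite orbF.
have ln_le : ln (n + m)%:R <= log2 (n + m)%:R :> R.
  by apply: ln_le_log2; rewrite ler1n addn_gt0 n0.
have ln_gt0 : 0 < ln (n + m)%:R :> R by rewrite ln_gt0 // ltr1n (leq_add n0 m0).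
have budget : (deg_comp + n)%:R * m%:R * ln (n + m)%:R <= theta%:R / 2 ^+ 31 :> R.
  have mlog_gt0 : 0 < m%:R * log2 (n + m)%:R :> R.
    by rewrite mulr_gt0 ?ltr0n // (lt_le_trans ln_gt0).
  move: deg_comp_lt; rewrite ltrBrDr -natrD ltr_pdivlMr // => /ltW deg_comp_le.
  by rewrite [_ / 2 ^+ 31]mulrC; apply: le_trans deg_comp_le; rewrite -mulrA !ler_wpM2l.
have deg_f_le : (deg_f * (m %/ 128).+1 <= deg_comp)%N.
  apply: (approx_deg_block_comp n0 m0 I0c I1c Isc _ _ _ _ _ L_dual I0n I1n Isn); try lra.
  - by rewrite ler1n muln_gt0 m0.
  exact: ample_weight_of_budget.
have m_deg_f_le : (m * deg_f <= 128 * deg_comp)%N.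
  rewrite (leq_trans (leq_mul (ltnW (ltn_ceil m (isT : (0 < 128)%N))) (leqnn deg_f))) //.
  by rewrite mulnAC mulnC leq_mul2l mulnC deg_f_le orbT.
rewrite -mulrA -natrM mulrC ler_pdivrMr ?exprn_gt0 //.
apply: (@le_trans _ _ (deg_comp * 2 ^ 7)%:R); first by rewrite ler_nat [leqRHS]mulnC.
by rewrite natrM natrX ler_wpM2l // ler_weXn2l // ler1n.
Qed.

Theorem theorem4p6 (R : realType) :
  exists c : R, 0 < c < 1 /\
  forall (n m theta : nat) (f : 'rV[bool]_n -> option bool)
    (I0 I1 Is : set R^o),
    (0 < n)%N -> (0 < m)%N -> (0 < theta)%N ->
    I0 !=set0 -> I1 !=set0 -> Is !=set0 ->
    convex_set I0 -> convex_set I1 -> convex_set Is ->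
    let bound : R :=
      Num.min (c * m%:R * (deg_cube I0 I1 Is f)%:R)
              (c * theta%:R / (m%:R * log2 (n + m)%:R) - n%:R) in
    (bound <= (deg_le I0 I1 Is theta (block_comp f (@MPstar m)))%:R) /\
    (bound <= (deg_le I0 I1 Is theta (block_comp f (@negMPstar m)))%:R).
Proof.
exists (2 ^- 31); split.
  by rewrite invr_gt0 exprn_gt0 //= invf_lt1 ?exprn_gt0 // exprn_egt1 // ltr1n.
move=> n m theta f I0 I1 Is n0 m0 _ I0n I1n Isn I0c I1c Isc bound.
have [L L_dual] := MPstar_dual_pair R m0.
split; first exact: (deg_block_comp_ge theta f n0 m0 I0n I1n Isn I0c I1c Isc L_dual).
exact: (deg_block_comp_ge theta f n0 m0 I0n I1n Isn I0c I1c Isc (dual_pair_negb L_dual)).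
Qed.
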